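(* Let $n\ge1$, let $\Lambda=\mathrm{diag}\{\lambda_1,\lambda_2,\dots,\lambda_n\}$ with real numbers $0<\lambda_1<\lambda_2<\dots<\lambda_n$, let $\Gamma=[\beta_1,\beta_2,\dots,\beta_n]^T\in\mathbb{R}^n$, and for $N\ge 1$ let $\overline P_N=[\Gamma,\Lambda\Gamma,\dots,\Lambda^{N-1}\Gamma]\in\mathbb{R}^{n\times N}$. Then the volume of the zonotope $E_n(\overline P_N)$ generated by the pair $\{\Lambda,\Gamma\}$ is $$V_n(E_n(\overline P_N))=\left|\prod_{i=1}^{n}\beta_i\right|\,V_N^{\lambda_1\lambda_2\cdots\lambda_n},$$ where $$V_N^{\lambda_1\lambda_2\cdots\lambda_n}=\sum_{0\le i_1<i_2<\dots<i_n\le N-1}F_{\lambda_1\lambda_2\cdots\lambda_n}^{i_1i_2\cdots i_n},$$ and these quantities satisfy the recursion $$V_N^{\lambda_1\lambda_2\cdots\lambda_n}=V_{N-1}^{\lambda_1\lambda_2\cdots\lambda_n}+\sum_{j=1}^{n}(-1)^{n+j}\lambda_j^{N-1}\,V_{N-1}^{\lambda_1\lambda_2\cdots\lambda_n\setminus\lambda_j}.$$ Consequently, for fixed $n$, the volume $V_n(E_n(\overline P_N))$ can be computed by these equations with computational complexity $\mathcal{O}(N)$ in $N$ (complexity measured by the number of multiplications).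
   Context: The zonotope is $E_n(\overline P_N)=\{\sum_{i=0}^{N-1}c_i\Lambda^{i}\Gamma : c_i\in[0,1]\}\subset\mathbb{R}^n$, and $V_n$ denotes $n$-dimensional volume (Lebesgue measure). For real numbers $0<\mu_1<\dots<\mu_s$ and integers $0\le k_1<\dots<k_s$, $F_{\mu_1\cdots\mu_s}^{k_1\cdots k_s}=\det\bigl[\mu_a^{k_b}\bigr]_{a,b=1}^{s}$ (row index $a$, column index $b$). For any increasing sequence $0<\mu_1<\dots<\mu_s$ and $N\ge0$, $V_N^{\mu_1\cdots\mu_s}=\sum_{0\le k_1<\dots<k_s\le N-1}F_{\mu_1\cdots\mu_s}^{k_1\cdots k_s}$ (an empty sum, hence $0$, if $N<s$ and $s\ge1$), with the convention that it equals $1$ for the empty sequence ($s=0$). The notation $\lambda_1\lambda_2\cdots\lambda_n\setminus\lambda_j$ means that $\lambda_j$ is deleted from the sequence $\lambda_1\lambda_2\cdots\lambda_n$. In the complexity claim, the recursion is applied to all subsequences of $\lambda_1,\dots,\lambda_n$, and the multiplications needed to form the powers $\lambda_j^i$ are included in the count. *)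

(* Defs.v *)
From HB Require Import structures.
From mathcomp Require Import all_boot all_order all_algebra.
From mathcomp Require Import all_classical all_reals all_analysis.
Set Implicit Arguments.
Unset Strict Implicit.
Unset Printing Implicit Defensive.
Import Order.TTheory GRing.Theory Num.Theory.
Import numFieldNormedType.Exports.
Local Open Scope classical_set_scope.
Local Open Scope ring_scope.

Section lebesgue_tuple.
Variable R : realType.
Local Notation TR := (measurableTypeR R).

Definition cons_pair n (p : TR * n.-tuple TR) : n.+1.-tuple TR :=
  [the n.+1.-tuple TR of p.1 :: p.2].

(* Lebesgue measure on (the Borel sets of) R^n, as the n-fold product of the
   library's Lebesgue measure on R; R^0 is a point of mass 1. *)
Fixpoint lebesgue_tuple n : set (n.-tuple TR) -> \bar R :=
  match n with
  | 0 => @dirac _ (0.-tuple TR) [tuple] R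
  | n.+1 =>
      fun A => (@lebesgue_measure R \x @lebesgue_tuple n)%E (@cons_pair n @^-1` A)
  end.

Lemma measurable_cons_pair n : measurable_fun setT (@cons_pair n).
Proof. exact: measurable_cons. Qed.

Definition uncons_pair n (t : n.+1.-tuple TR) : TR * n.-tuple TR :=
  (thead t, [tuple of behead t]).

Lemma measurable_uncons_pair n : measurable_fun setT (@uncons_pair n).
Proof.
by apply/measurable_fun_pair; [exact: measurable_tnth|exact: measurable_behead].
Qed.

Lemma cons_pairK n : cancel (@cons_pair n) (@uncons_pair n).
Proof. by move=> [x t]; congr pair; exact: val_inj. Qed.

Lemma uncons_pairK n : cancel (@uncons_pair n) (@cons_pair n).
Proof. by move=> t; rewrite [RHS]tuple_eta; apply: val_inj. Qed.

Lemma lebesgue_tuple_sigma_finite_measure n :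
  {mu : {sigma_finite_measure set (n.-tuple TR) -> \bar R} |
    (mu : set _ -> _) = @lebesgue_tuple n}.
Proof.
elim: n => [|n [mu muE]]; first by exists (@dirac _ (0.-tuple TR) [tuple] R).
pose P : {measure set (TR * n.-tuple TR)%type -> \bar R} :=
  (@lebesgue_measure R \x mu)%E.
pose nu : {measure set (n.+1.-tuple TR) -> \bar R} :=
  measure_function_pushforward__canonical__measure_function_Measure P
    (@measurable_cons_pair n).
have nu_sf : sigma_finite setT nu.
  have [F FT mF] : sigma_finite setT P.
    have /sigma_finiteP[F [TF ndF Foo]] := sigma_finiteT (@lebesgue_measure R).
    have /sigma_finiteP[G [TG ndG Goo]] := sigma_finiteT mu.
    exists (fun k => F k `*` G k).
      rewrite -setXTT TF TG predeqE => -[x y]; split=> [[[i _ Fx] [j _ Gy]]|].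
        exists (maxn i j) => //; split => /=.
          by move: (x) Fx; exact/subsetPset/ndF/leq_maxl.
        by move: (y) Gy; exact/subsetPset/ndG/leq_maxr.
      by move=> [i _ [? ?]]; split; exists i.
    move=> k; have [mF Fk] := Foo k; have [mG Gk] := Goo k.
    split; first exact: measurableX.
    by rewrite /P /= product_measure1E// lte_mul_pinfty// ge0_fin_numE.
  exists (fun k => @uncons_pair n @^-1` F k).
    by rewrite -preimage_bigcup -FT.
  move=> k; have [mFk Fk_fin] := mF k; split.
    by rewrite -[X in measurable X]setTI; exact: measurable_uncons_pair.
  rewrite /nu /= /pushforward -comp_preimage.
  by rewrite (_ : _ \o _ = idfun)//; apply/funext => x; exact: cons_pairK.
pose nu' : {sigma_finite_measure set (n.+1.-tuple TR) -> \bar R} :=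
  HB.pack (nu : set _ -> _) nu (Measure_isSigmaFinite.Build _ _ _ _ nu_sf).
by exists nu'; rewrite /= -muE.
Qed.

Lemma lebesgue_tuple0 n : @lebesgue_tuple n set0 = 0%E.
Proof.
by have [mu <-] := lebesgue_tuple_sigma_finite_measure n; exact: measure0.
Qed.

Lemma lebesgue_tuple_ge0 n A : (0 <= @lebesgue_tuple n A)%E.
Proof.
by have [mu <-] := lebesgue_tuple_sigma_finite_measure n; exact: measure_ge0.
Qed.

Lemma lebesgue_tuple_sigma_additive n : semi_sigma_additive (@lebesgue_tuple n).
Proof.
have [mu <-] := lebesgue_tuple_sigma_finite_measure n.
exact: measure_semi_sigma_additive.
Qed.

Lemma lebesgue_tuple_sigma_finite n : sigma_finite setT (@lebesgue_tuple n).
Proof.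
by have [mu <-] := lebesgue_tuple_sigma_finite_measure n; exact: sigma_finiteT.
Qed.

HB.instance Definition _ n := isMeasure.Build _ _ _ (@lebesgue_tuple n)
  (@lebesgue_tuple0 n) (@lebesgue_tuple_ge0 n)
  (@lebesgue_tuple_sigma_additive n).
HB.instance Definition _ n := Measure_isSigmaFinite.Build _ _ _
  (@lebesgue_tuple n) (@lebesgue_tuple_sigma_finite n).

Lemma lebesgue_tuple_box n (A : 'I_n -> set TR) :
  (forall i, measurable (A i)) ->
  lebesgue_tuple [set t | forall i, A i (tnth t i)] =
  (\prod_(i < n) lebesgue_measure (A i))%E.
Proof.
elim: n A => [|n IH] A mA.
  rewrite big_ord0 /= diracE mem_set//=; by case.
rewrite big_ord_recl -IH //=.
rewrite (_ : _ @^-1` _ =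
  A ord0 `*` [set t | forall i, A (lift ord0 i) (tnth t i)]).
  rewrite product_measure1E//=.
  rewrite (_ : [set t | _] = \bigcap_(i in [set: 'I_n])
      ((@tnth _ _)^~ i @^-1` A (lift ord0 i))).
    apply: fin_bigcap_measurable => // i _.
    by rewrite -[X in measurable X]setTI; apply: measurable_tnth.
  by apply/seteqP; split => t /= h i; [move=> _|]; exact: h.
apply/seteqP; split => -[x t] /=.
  move=> h; split => [|i] /=; first exact: (h ord0).
  by have := h (lift ord0 i); rewrite tnthS.
move=> [h0 h] i; case: (unliftP ord0 i) => [j ->|->]; last exact: h0.
by rewrite tnthS; exact: h.
Qed.
End lebesgue_tuple.

Section zonotope.
Variable R : realType.

Definition volume n (A : set 'cV[R]_n) : \bar R :=
  @lebesgue_tuple R n [set t | A (\col_i tnth t i)].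

Definition zonotope n N (P : 'M[R]_(n, N)) : set 'cV[R]_n :=
  [set x | exists2 c : 'I_N -> R, (forall i, 0 <= c i <= 1) &
           x = \sum_(i < N) c i *: col i P].

(* The n x N matrix [G, L G, ..., L^(N-1) G]. *)
Definition reachability_mx n (L : 'M[R]_n) (G : 'cV[R]_n) N : 'M[R]_(n, N) :=
  \matrix_(i, k) (L ^+ k *m G) i 0.

Definition Fdet s (mu : 'rV[R]_s) (k : 'I_s -> nat) : R :=
  \det (\matrix_(a, b) mu 0 a ^+ k b).

(* The sum ranges over the strictly increasing maps 'I_s -> {0, ..., N-1};
   for s = 0 there is exactly one such map, with determinant 1. *)
Definition Vsum N s (mu : 'rV[R]_s) : R :=
  \sum_(k : {ffun 'I_s -> 'I_N} |
        [forall a : 'I_s, forall b : 'I_s, (a < b)%N ==> (k a < k b)%N])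
    Fdet mu (fun a => k a).

End zonotope.

(* Straight-line programs over a type X of registers: the first argument of an
   instruction is the register it writes. *)
Inductive instr (X : Type) :=
| IConst of X & bool
| ICopy of X & X
| IAdd of X & X & X
| ISub of X & X & X
| IMul of X & X & X
| IAbs of X & X.

Section programs.
Variables (R : realType) (X : eqType).

Definition write (s : X -> R) (d : X) (v : R) : X -> R :=
  fun x => if x == d then v else s x.

Definition step (s : X -> R) (i : instr X) : X -> R :=
  match i with
  | IConst d b => write s d b%:R
  | ICopy d x => write s d (s x)
  | IAdd d x y => write s d (s x + s y)
  | ISub d x y => write s d (s x - s y)
  | IMul d x y => write s d (s x * s y)
  | IAbs d x => write s d `|s x|
  end.

Definition run (p : seq (instr X)) (s : X -> R) : X -> R := foldl step s p.

Definition is_mul (i : instr X) : bool := if i is IMul _ _ _ then true else false.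

Definition mul_count (p : seq (instr X)) : nat := count is_mul p.

End programs.

(* Lam j and Beta j are the inputs; Pow j m holds lambda_j^m, and Val J m holds
   V_m of the subsequence of lambda_1, ..., lambda_n indexed by J. *)
Inductive reg (n : nat) :=
| Lam of 'I_n
| Beta of 'I_n
| Pow of 'I_n & nat
| Val of {set 'I_n} & nat
| Tmp
| Prod
| Out.
Arguments Tmp {n}.
Arguments Prod {n}.
Arguments Out {n}.

Section reg_eqType.
Variable n : nat.

Definition reg_encode (x : reg n) :
    ('I_n + 'I_n + 'I_n * nat + {set 'I_n} * nat + 'I_3)%type :=
  match x with
  | Lam j => inl (inl (inl (inl j)))
  | Beta j => inl (inl (inl (inr j)))
  | Pow j m => inl (inl (inr (j, m)))
  | Val J m => inl (inr (J, m))
  | Tmp => inr (inord 0)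
  | Prod => inr (inord 1)
  | Out => inr (inord 2)
  end.

Definition reg_decode
    (x : ('I_n + 'I_n + 'I_n * nat + {set 'I_n} * nat + 'I_3)%type) : reg n :=
  match x with
  | inl (inl (inl (inl j))) => Lam j
  | inl (inl (inl (inr j))) => Beta j
  | inl (inl (inr (j, m))) => Pow j m
  | inl (inr (J, m)) => Val J m
  | inr i => nth Out [:: Tmp; Prod] i
  end.

Lemma reg_encodeK : cancel reg_encode reg_decode.
Proof. by case=> //=; rewrite inordK. Qed.

HB.instance Definition _ := Equality.copy (reg n) (can_type reg_encodeK).
End reg_eqType.

Section volume_program.
Variable n : nat.
Implicit Types (J : {set 'I_n}) (j : 'I_n) (m N : nat).

Definition init_prog : seq (instr (reg n)) :=
  [seq IConst (Val J 0) (J == finset.set0) | J <- enum {set 'I_n}] ++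
  [seq IConst (Pow j 0) true | j <- enum 'I_n].

(* The 1-based position of j in the subsequence indexed by J. *)
Definition position J j : nat := #|[set i in J | (i <= j)%N]%SET|.

(* The summand of index j in the recursion for J; its sign
   (-1)^(#|J| + position J j) selects an addition or a subtraction. *)
Definition term_prog m J j : seq (instr (reg n)) :=
  [:: IMul Tmp (Pow j m) (Val (J :\ j)%SET m);
      if odd (#|J| + position J j) then ISub (Val J m.+1) (Val J m.+1) Tmp
      else IAdd (Val J m.+1) (Val J m.+1) Tmp].

Definition update_prog m J : seq (instr (reg n)) :=
  ICopy (Val J m.+1) (Val J m) :: flatten [seq term_prog m J j | j <- enum J].

Definition stage_prog m : seq (instr (reg n)) :=
  flatten [seq update_prog m J | J <- enum {set 'I_n}] ++
  [seq IMul (Pow j m.+1) (Pow j m) (Lam j) | j <- enum 'I_n].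

Definition output_prog N : seq (instr (reg n)) :=
  IConst Prod true :: [seq IMul Prod Prod (Beta j) | j <- enum 'I_n] ++
  [:: IAbs Prod Prod; IMul Out Prod (Val [set: 'I_n]%SET N)].

Definition volume_prog N : seq (instr (reg n)) :=
  init_prog ++ flatten [seq stage_prog m | m <- iota 0 N] ++ output_prog N.

Definition input (R : realType) (lam : 'rV[R]_n) (G : 'cV[R]_n) (x : reg n) : R :=
  match x with
  | Lam j => lam 0 j
  | Beta j => G j 0
  | _ => 0
  end.

End volume_program.

(* Main.v *)
Require Import Defs.
From HB Require Import structures.
From mathcomp Require Import all_boot all_order all_algebra.
From mathcomp Require Import all_classical all_reals all_analysis.
From mathcomp Require Import measurable_realfun.
From mathcomp Require polyrcf.
From mathcomp Require Import zify ring lra.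
Set Implicit Arguments.
Unset Strict Implicit.
Unset Printing Implicit Defensive.
Import Order.TTheory GRing.Theory Num.Theory.
Import numFieldNormedType.Exports.
Local Open Scope classical_set_scope.
Local Open Scope ring_scope.

(* Write a zonotope as Z + [0, v] with v its last generator. Two shears, which
   preserve volume, bring v to a e_1. Along the first axis every nonempty fibre
   of Z is a compact interval, which adding [0, a e_1] lengthens by |a|, so
     vol (Z + [0, a e_1]) = vol Z + |a| vol (pr Z),
   where pr forgets the first coordinate. Induction on the number of generators
   gives vol Z as the sum of |det| over all choices of n generators. For the
   generators L^k G these determinants are (prod beta_i) F, and F > 0: by Rolle,
   a sum of s monomials has fewer than s positive zeros, so F does not vanish as
   its last node increases to infinity, where its sign is that of a smaller F.
   The recursion separates the index sets containing N - 1 and expands their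
   determinants along the last column. *)

(** * Sums over increasing index sequences *)

(* [vs] lists the available elements in reverse order: each selected
   subsequence is passed to [F] in the order opposite to that of [vs]. *)
Fixpoint subsum (T : Type) (V : nmodType) (k : nat) (vs : seq T)
    (F : seq T -> V) : V :=
  match k, vs with
  | 0, _ => F [::]
  | _.+1, [::] => 0
  | k'.+1, v :: vs' =>
      subsum k vs' F + subsum k' vs' (fun w => F (rcons w v))
  end.

Section subsum_theory.
Variables (T : Type) (V : nmodType).
Implicit Types (k : nat) (vs w : seq T) (F G : seq T -> V).

Lemma subsum0 vs F : subsum 0 vs F = F [::].
Proof. by case: vs. Qed.

Lemma eq_subsum_size k vs F G :
  (forall w, size w = k -> F w = G w) -> subsum k vs F = subsum k vs G.
Proof.
elim: vs k F G => [|v vs IH] [|k] F G FG //=; try by rewrite FG.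
congr (_ + _); first exact: IH.
by apply: IH => w wk; rewrite FG// size_rcons wk.
Qed.

Lemma subsum_sum (I : finType) k vs (F : I -> seq T -> V) :
  subsum k vs (fun w => \sum_i F i w) = \sum_i subsum k vs (F i).
Proof.
elim: vs k F => [|v vs IH] [|k] F //=; first by rewrite big1.
by rewrite !IH big_split.
Qed.

End subsum_theory.

Lemma subsum_map (S T : Type) (V : nmodType) (f : S -> T) k (us : seq S)
    (F : seq T -> V) :
  subsum k (map f us) F = subsum k us (F \o map f).
Proof.
elim: us k F => [|u us IH] [|k] F //=; rewrite !IH; congr (_ + _).
by apply: eq_subsum_size => w _ /=; rewrite map_rcons.
Qed.

Lemma subsumZ (T : Type) (R : pzRingType) k (vs : seq T) (c : R) F :
  subsum k vs (fun w => c * F w) = c * subsum k vs F.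
Proof.
elim: vs k F => [|v vs IH] [|k] F //=; first by rewrite mulr0.
by rewrite !IH mulrDr.
Qed.

Lemma rev_iota0S N : rev (iota 0 N.+1) = N :: rev (iota 0 N).
Proof. by rewrite -addn1 iotaD rev_cat. Qed.

Lemma eq_subsum_iota (V : nmodType) k N (F G : seq nat -> V) :
  (forall w, size w = k -> sorted ltn w -> F w = G w) ->
  subsum k (rev (iota 0 N)) F = subsum k (rev (iota 0 N)) G.
Proof.
(* The bound [all (ltn^~ N) w] is carried through the induction so that appending [N] to [w] keeps
   it sorted. *)
suff H : forall k (F G : seq nat -> V),
    (forall w, size w = k -> sorted ltn w -> all (ltn^~ N) w -> F w = G w) ->
    subsum k (rev (iota 0 N)) F = subsum k (rev (iota 0 N)) G.
  by move=> FG; apply: H => w ? ? _; exact: FG.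
elim: N {k F G} => [|N IH] k F G FG.
  by case: k FG => [|k] FG //=; exact: FG.
rewrite rev_iota0S.
case: k FG => [|k] FG /=; first by apply: FG.
congr (_ + _).
  by apply: IH => w wk ws wN; apply: FG => //; apply: sub_all wN => i /ltnW.
apply: IH => w wk ws wN; apply: FG.
- by rewrite size_rcons wk.
- by rewrite (sorted_pairwise ltn_trans) pairwise_rcons wN
    -(sorted_pairwise ltn_trans).
- rewrite all_rcons; apply/andP; split; first exact: ltnSn.
  by apply: sub_all wN => i /ltnW.
Qed.

(** * Increasing maps and increasing index lists *)

Section increasing_maps.

Definition incr s N (k : {ffun 'I_s -> 'I_N}) : bool :=
  [forall a : 'I_s, forall b : 'I_s, (a < b)%N ==> (k a < k b)%N].

Lemma incrP s N (k : {ffun 'I_s -> 'I_N}) :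
  reflect (forall a b : 'I_s, (a < b)%N -> (k a < k b)%N) (incr k).
Proof.
apply: (iffP forallP) => [h a b ab|h a].
  by move/forallP: (h a) => /(_ b)/implyP; exact.
by apply/forallP => b; apply/implyP; exact: h.
Qed.


(** An increasing map into [N.+1] values either misses the top value or takes it exactly at its last
    argument; [widen_incr] and [rcons_incr] parametrize these two cases. *)
Definition widen_incr s N (k : {ffun 'I_s -> 'I_N}) : {ffun 'I_s -> 'I_N.+1} :=
  [ffun i => widen_ord (leqnSn N) (k i)].

Definition rcons_incr s N (k : {ffun 'I_s -> 'I_N}) :
    {ffun 'I_s.+1 -> 'I_N.+1} :=
  [ffun i => if unlift ord_max i is Some j then widen_ord (leqnSn N) (k j)
             else ord_max].

Lemma widen_incr_inj s N : injective (@widen_incr s N).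
Proof.
move=> k k' /ffunP e; apply/ffunP => i; apply: val_inj.
by have := e i; rewrite !ffunE => /(congr1 val).
Qed.

Lemma rcons_incr_inj s N : injective (@rcons_incr s N).
Proof.
move=> k k' /ffunP e; apply/ffunP => i; apply: val_inj.
by have := e (lift ord_max i); rewrite !ffunE liftK => /(congr1 val).
Qed.

Lemma rcons_incr_max s N (k : {ffun 'I_s -> 'I_N}) :
  rcons_incr k ord_max = ord_max.
Proof. by rewrite ffunE unlift_none. Qed.

Lemma rcons_incr_lift s N (k : {ffun 'I_s -> 'I_N}) i :
  rcons_incr k (lift ord_max i) = k i :> nat.
Proof. by rewrite ffunE liftK. Qed.

(** By monotonicity the last value is the largest, so if it is not the top one then all values fit
    into ['I_N]. *)
Lemma widen_incrE s N :
  [set k : {ffun 'I_s.+1 -> 'I_N.+1} | incr k && (k ord_max != ord_max)]%SET =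
  [set widen_incr k | k in [set k : {ffun 'I_s.+1 -> 'I_N} | incr k]%SET]%SET.
Proof.
apply/setP => k; rewrite !inE; apply/andP/imsetP => [[/incrP ik kmax]|].
  have kN i : (k i < N)%N.
    have kmN : (k ord_max < N)%N.
      by rewrite ltn_neqAle -ltnS ltn_ord andbT; apply: contra kmax => /eqP e;
         apply/eqP/val_inj.
    have [->//|ne] := eqVneq i ord_max.
    apply: ltn_trans kmN; apply: ik.
    by rewrite ltn_neqAle -ltnS ltn_ord andbT.
  exists [ffun i => Ordinal (kN i)].
    by rewrite inE; apply/incrP => a b /ik; rewrite !ffunE.
  by apply/ffunP => i; apply: val_inj; rewrite !ffunE.
move=> [k' + ->]; rewrite inE => /incrP ik'; split.
  by apply/incrP => a b /ik'; rewrite !ffunE.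
by rewrite ffunE -val_eqE/= ltn_eqF.
Qed.

Lemma rcons_incrE s N :
  [set k : {ffun 'I_s.+1 -> 'I_N.+1} | incr k && (k ord_max == ord_max)]%SET =
  [set rcons_incr k | k in [set k : {ffun 'I_s -> 'I_N} | incr k]%SET]%SET.
Proof.
apply/setP => k; rewrite !inE; apply/andP/imsetP => [[/incrP ik /eqP kmax]|].
  have kN i : (k (lift ord_max i) < N)%N.
    have := ik (lift ord_max i) ord_max; rewrite kmax lift_max; apply.
    exact: ltn_ord.
  exists [ffun i => Ordinal (kN i)].
    by rewrite inE; apply/incrP => a b ab; rewrite !ffunE; apply: ik;
       rewrite !lift_max.
  apply/ffunP => i; apply: val_inj; rewrite ffunE.
  by case: unliftP => [j ->|->]; rewrite ?ffunE ?kmax.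
move=> [k' + ->]; rewrite inE => /incrP ik'; split; last first.
  by rewrite rcons_incr_max.
apply/incrP => a b; case: (unliftP ord_max a) => [i ->|->]; last first.
  by rewrite ltnNge -ltnS ltn_ord.
case: (unliftP ord_max b) => [j ->|->].
  by rewrite !lift_max !rcons_incr_lift; exact: ik'.
by move=> _; rewrite rcons_incr_max rcons_incr_lift /=.
Qed.

Definition incr_seq s N (k : {ffun 'I_s -> 'I_N}) : seq nat :=
  [seq val (k i) | i <- enum 'I_s].

Lemma incr_seq_widen s N (k : {ffun 'I_s -> 'I_N}) :
  incr_seq (widen_incr k) = incr_seq k.
Proof. by apply: eq_map => i; rewrite ffunE. Qed.

Lemma incr_seq_rcons s N (k : {ffun 'I_s -> 'I_N}) :
  incr_seq (rcons_incr k) = rcons (incr_seq k) N.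
Proof.
rewrite /incr_seq enum_ordSr map_rcons rcons_incr_max; congr rcons.
rewrite -map_comp; apply: eq_map => i /=.
have -> : widen_ord (leqnSn s) i = lift ord_max i.
  exact/val_inj/esym/lift_max.
exact: rcons_incr_lift.
Qed.

Lemma incr_ffun_sum0 (V : nmodType) N (F : seq nat -> V) :
  \sum_(k : {ffun 'I_0 -> 'I_N} | incr k) F (incr_seq k) = F [::].
Proof.
have k0 : {ffun 'I_0 -> 'I_N} by apply: finfun => -[].
rewrite (big_pred1 k0) /incr_seq ?enum_ord0// => k.
apply/idP/eqP => _; first by apply/ffunP => -[].
by apply/incrP => -[].
Qed.

(** Splitting on whether the last value is the top one reproduces the two branches of [subsum]; the
    list is reversed so that this top value is its head. *)
Lemma incr_ffun_sum (V : nmodType) s N (F : seq nat -> V) :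
  \sum_(k : {ffun 'I_s -> 'I_N} | incr k) F (incr_seq k) =
  subsum s (rev (iota 0 N)) F.
Proof.
elim: N s F => [|N IH] [|s] F; rewrite ?subsum0 ?incr_ffun_sum0//.
  by rewrite big_pred0// => k; case: (k ord0).
rewrite rev_iota0S.
rewrite (bigID (fun k : {ffun _} => k ord_max == ord_max)) /= addrC.
congr (_ + _); rewrite -IH -[LHS]big_set ?widen_incrE ?rcons_incrE.
  rewrite big_imset/=; last by move=> ? ? _ _; exact: widen_incr_inj.
  by rewrite big_set; apply: eq_bigr => k _; rewrite incr_seq_widen.
rewrite big_imset/=; last by move=> ? ? _ _; exact: rcons_incr_inj.
by rewrite big_set; apply: eq_bigr => k _; rewrite incr_seq_rcons.
Qed.

End increasing_maps.

(** * The recursion for [Vsum] *)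

Section Vsum_theory.
Variable R : realType.

Lemma VsumE N s (mu : 'rV[R]_s) :
  Vsum N mu = subsum s (rev (iota 0 N)) (fun w => Fdet mu (nth 0%N w)).
Proof.
rewrite -incr_ffun_sum; apply: eq_bigr => k _; congr (\det _).
by apply/matrixP => a b; rewrite !mxE (nth_map b) ?size_enum_ord// nth_ord_enum.
Qed.

Lemma Vsum_dim0 N (mu : 'rV[R]_0) : Vsum N mu = 1.
Proof. by rewrite VsumE subsum0 /Fdet det_mx00. Qed.

Lemma Vsum_empty s (mu : 'rV[R]_s.+1) : Vsum 0 mu = 0.
Proof. by rewrite VsumE. Qed.

Lemma Fdet_rcons s (mu : 'rV[R]_s.+1) (w : seq nat) N : size w = s ->
  Fdet mu (nth 0%N (rcons w N)) =
  \sum_(j < s.+1)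
    (-1) ^+ (s + j) * mu 0 j ^+ N * Fdet (col' j mu) (nth 0%N w).
Proof.
move=> ws; rewrite /Fdet (expand_det_col _ ord_max); apply: eq_bigr => j _.
rewrite !mxE nth_rcons ws ltnn eqxx /cofactor mulrCA mulrA addnC.
congr (_ * \det _); apply/matrixP => a b.
by rewrite !mxE nth_rcons lift_max ws ltn_ord.
Qed.

Lemma Vsum_rec s (mu : 'rV[R]_s) N :
  Vsum N.+1 mu = Vsum N mu +
    \sum_(j < s) (-1) ^+ (s + j.+1) * mu 0 j ^+ N * Vsum N (col' j mu).
Proof.
case: s mu => [|s] mu; first by rewrite big_ord0 !Vsum_dim0 addr0.
rewrite !VsumE rev_iota0S /=; congr (_ + _).
rewrite (eq_subsum_size _ (fun w => @Fdet_rcons s mu w N)) subsum_sum.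
apply: eq_bigr => j _; rewrite subsumZ VsumE.
(* The zero-based exponent [s + j] and the one-based [s.+1 + j.+1] differ by two, so the signs
   agree. *)
by rewrite addnS addSn !exprS !mulN1r opprK.
Qed.

End Vsum_theory.

(** * Positivity of generalized Vandermonde determinants *)

Section total_positivity.

(** Dividing by the lowest power leaves a constant term, which differentiation removes. Rolle puts
    [s] zeros of the derivative between the [s.+1] nodes, so by induction all higher coefficients
    vanish; evaluating at the first node then kills the lowest one. *)
Lemma lacunary_poly_eq0 (R : rcfType) s (k : nat -> nat) (c mu : nat -> R) :
  (forall a b, (a < b < s)%N -> (k a < k b)%N) ->
  (forall a, (a < s)%N -> 0 < mu a) ->
  (forall a b, (a < b < s)%N -> mu a < mu b) ->
  (forall a, (a < s)%N -> \sum_(b < s) c b * mu a ^+ k b = 0) ->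
  forall b, (b < s)%N -> c b = 0.
Proof.
elim: s k c mu => // s IH k c mu ik mu0 imu root.
have k0 b : (b < s.+1)%N -> (k 0%N <= k b)%N.
  by case: b => // b bs; rewrite ltnW// ik.
pose q : {poly R} := \sum_(b < s.+1) c b *: 'X^(k b - k 0%N).
have rootq a : (a < s.+1)%N -> q.[mu a] = 0.
  move=> sa; have nz : mu a ^+ k 0%N != 0 by rewrite expf_neq0// gt_eqF// mu0.
  apply: (mulfI nz); rewrite mulr0 -[RHS](root a sa) horner_sum mulr_sumr.
  apply: eq_bigr => b _; rewrite hornerZ hornerXn mulrCA -exprD subnKC//.
  exact: k0.
have dq x : q^`().[x] =
    \sum_(b < s) (c b.+1 * (k b.+1 - k 0%N)%:R) * x ^+ (k b.+1 - k 0%N).-1.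
  rewrite /q big_ord_recl subnn expr0 derivD derivZ derivC scaler0 add0r.
  rewrite raddf_sum horner_sum; apply: eq_bigr => b _.
  by rewrite /= derivZ derivXn hornerZ hornerMn hornerXn -mulr_natl mulrA.
have [t tP] : exists t : nat -> R, forall a, (a < s)%N ->
    mu a < t a < mu a.+1 /\ q^`().[t a] = 0.
  (* The bound on [a] moves under the existential so that [choice] yields a total function. *)
  suff : forall a, exists x, (a < s)%N -> mu a < x < mu a.+1 /\ q^`().[x] = 0.
    by move=> /choice[t tP]; exists t.
  move=> a; case: (ltnP a s) => [sa|]; last by exists 0.
  have lt_mu : mu a < mu a.+1 by rewrite imu// ltnSn.
  have [|x] := @polyrcf.poly_rolle _ _ _ q lt_mu.
    by rewrite !rootq// ltnW.
  by rewrite in_itv/= => xI dx; exists x.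
have cS b : (b < s)%N -> c b.+1 * (k b.+1 - k 0%N)%:R = 0.
  apply: (IH (fun b => (k b.+1 - k 0%N).-1)
    (fun b => c b.+1 * (k b.+1 - k 0%N)%:R) t) =>
    [i j /andP[ij js]|i si|i j /andP[ij js]|i si].
  - have ki : (k 0%N < k i.+1)%N by apply: ik; lia.
    have kij : (k i.+1 < k j.+1)%N by apply: ik; lia.
    by lia.
  - by have [/andP[/(le_lt_trans _)-> //]] := tP i si; rewrite ltW ?mu0// ltnW.
  - have [/andP[_ ti] _] := tP i (ltn_trans ij js).
    have [/andP[tj _] _] := tP j js; apply: (lt_le_trans ti).
    apply: le_trans (ltW tj); move: ij; rewrite leq_eqVlt => /orP[/eqP->//|ij].
    by rewrite ltW// imu// ij ltnW.
  - by rewrite -dq; have [] := tP i si.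
have c0 b : (b < s)%N -> c b.+1 = 0.
  move=> bs; have /eqP := cS b bs; rewrite mulf_eq0 pnatr_eq0 => /orP[/eqP//|].
  by rewrite subn_eq0 leqNgt ik.
case=> [_|b]; last exact: c0.
have /eqP := root 0%N isT; rewrite big_ord_recl big1 => [|i _].
  by rewrite addr0 mulf_eq0 expf_eq0 (gt_eqF (mu0 0%N _))// andbF orbF => /eqP.
by rewrite lift0 c0// mul0r.
Qed.

Variable R : realType.

(** A kernel vector of the matrix is the coefficient vector of a sum of [s] monomials vanishing at
    all [s] nodes, hence zero. *)
Lemma Fdet_neq0 s (mu : 'rV[R]_s) (k : nat -> nat) :
  (forall a b, (a < b < s)%N -> (k a < k b)%N) ->
  (forall a, 0 < mu 0 a) ->
  (forall a b : 'I_s, (a < b)%N -> mu 0 a < mu 0 b) ->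
  Fdet mu k != 0.
Proof.
case: s mu => [|s] mu ik mu0 imu; first by rewrite /Fdet det_mx00 oner_neq0.
apply/negP; rewrite /Fdet -det_tr => /det0P[v /negP v0 vM]; apply: v0.
apply/eqP/rowP => b; rewrite mxE -[b in LHS]inord_val.
apply: (@lacunary_poly_eq0 _ s.+1 k (fun b => v 0 (inord b))
  (fun a => mu 0 (inord a))) => // [a c|a sa].
- by move=> /andP[ac cs]; apply: imu; rewrite !inordK// (ltn_trans ac).
- move/rowP: vM => /(_ (inord a)); rewrite !mxE => e; rewrite -[RHS]e.
  by apply: eq_bigr => i _; rewrite !mxE inord_val.
Qed.

(* As a function of the last node, the determinant is a polynomial with positive
   leading coefficient which does not vanish beyond the previous nodes. *)
Lemma Fdet_gt0 s (mu : 'rV[R]_s) (k : nat -> nat) :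
  (forall a b, (a < b < s)%N -> (k a < k b)%N) ->
  (forall a, 0 < mu 0 a) ->
  (forall a b : 'I_s, (a < b)%N -> mu 0 a < mu 0 b) ->
  0 < Fdet mu k.
Proof.
elim: s mu => [|s IH] mu ik mu0 imu; first by rewrite /Fdet det_mx00.
pose nu x : 'rV[R]_s.+1 :=
  \row_a if unlift ord_max a is Some _ then mu 0 a else x.
have nuE a x : a != ord_max -> nu x 0 a = mu 0 a.
  by move=> amax; rewrite mxE; case: unliftP amax => [//|->]; rewrite eqxx.
have nu_max x : nu x 0 ord_max = x by rewrite mxE unlift_none.
have nu_mu : nu (mu 0 ord_max) = mu.
  by apply/rowP => a; have [->|/nuE->//] := eqVneq a ord_max; rewrite nu_max.
pose cf (b : 'I_s.+1) : R :=
  cofactor (\matrix_(a, b) mu 0 a ^+ k b : 'M[R]_s.+1) ord_max b.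
pose p : {poly R} := \sum_(b < s.+1) cf b *: 'X^(k b).
have pE x : Fdet (nu x) k = p.[x].
  rewrite /Fdet (expand_det_row _ ord_max) horner_sum.
  apply: eq_bigr => b _; rewrite hornerZ hornerXn mulrC mxE nu_max.
  congr (_ * _).
  congr (_ * \det _); apply/matrixP => i j; rewrite !mxE.
  by rewrite liftK.
(* The corner cofactor has the even sign exponent [s + s], and its minor is the determinant on the
   first [s] nodes, positive by induction. *)
have cf_max : 0 < cf ord_max.
  rewrite /cf /cofactor -signr_odd oddD addbb mul1r.
  have := IH (col' ord_max mu); rewrite /Fdet.
  set d1 := \det _; set d2 := \det _.
  suff -> : d1 = d2.
    apply=> [a b /andP[ab bs]|a|a b ab]; first by rewrite ik// ab ltnW.
      by rewrite mxE.
    by rewrite !mxE imu// !lift_max.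
  by congr (\det _); apply/matrixP => i j; rewrite !mxE lift_max.
have p_lead : lead_coef p = cf ord_max.
  have coefp : p`_(k s) = cf ord_max.
    rewrite coef_sum (bigD1 ord_max)//= coefZ coefXn eqxx mulr1.
    rewrite big1 ?addr0// => b bmax.
    rewrite coefZ coefXn gtn_eqF ?mulr0// ik// ltnSn andbT.
    by rewrite ltn_neqAle -ltnS ltn_ord andbT.
  rewrite lead_coefE (_ : size p = (k s).+1)//.
  apply/eqP; rewrite eqn_leq; apply/andP; split.
    apply: (leq_trans (size_sum _ _ _)); apply/bigmax_leqP => b _.
    rewrite (leq_trans (size_scale_leq _ _))// size_polyXn ltnS.
    have := ltn_ord b; rewrite ltnS leq_eqVlt => /orP[/eqP->//|bs].
    by rewrite ltnW// ik// bs ltnSn.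
  rewrite ltnNge; apply/negP => /leq_sizeP/(_ _ (leqnn _)).
  by rewrite coefp; apply/eqP; rewrite gt_eqF.
(* Moving the last node up to [x] keeps the nodes positive and increasing. *)
have p_neq0 x : mu 0 ord_max <= x -> p.[x] != 0.
  move=> mux; rewrite -pE; apply: Fdet_neq0 => // [a|a b ab].
    have [->|/nuE->//] := eqVneq a ord_max; rewrite nu_max.
    exact: lt_le_trans mux.
  have amax : a != ord_max.
    by rewrite -val_eqE ltn_eqF// (leq_trans ab)// -ltnS ltn_ord.
  rewrite (nuE a)//; have [bmax|/nuE->] := eqVneq b ord_max; last exact: imu.
  by rewrite bmax nu_max; apply: lt_le_trans mux; rewrite imu// -bmax.
have [M pM] : exists M, forall x, M <= x -> 0 < p.[x].
  have [|M pM] := @polyrcf.poly_pinfty_gt_lc _ p; first by rewrite p_lead.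
  by exists M => x /pM; apply: lt_le_trans; rewrite p_lead.
rewrite -nu_mu pE ltNge; apply/negP => pmu.
(* [p] is positive at [x]; a nonpositive value at the last node would force a root in between,
   against [p_neq0]. *)
pose x := Num.max M (mu 0 ord_max).
have mux : mu 0 ord_max <= x by rewrite le_max lexx orbT.
have [|y] := @polyrcf.poly_ivt _ p _ _ mux.
  by rewrite mulr_le0_ge0// ltW// pM// le_max lexx.
by rewrite in_itv/= => /andP[/p_neq0/negP py _] /eqP yr; apply: py; apply/eqP.
Qed.

End total_positivity.

(** * Lebesgue measure on column vectors *)

Section volume_theory.
Variable R : realType.
Local Notation TR := (measurableTypeR R).

Definition tcol n (t : n.-tuple TR) : 'cV[R]_n := \col_i tnth t i.

(** Measurability is transported from tuples along [tcol], as [volume] transports the measure. *)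
Definition cV_measurable n (A : set 'cV[R]_n) : Prop :=
  measurable [set t : n.-tuple TR | A (tcol t)].

Definition cons_col n (x : R) (y : 'cV[R]_n) : 'cV[R]_n.+1 :=
  \col_i if unlift ord0 i is Some j then y j 0 else x.

Lemma cons_col0 n x (y : 'cV[R]_n) : cons_col x y ord0 0 = x.
Proof. by rewrite mxE unlift_none. Qed.

Lemma cons_col_lift n x (y : 'cV[R]_n) i :
  cons_col x y (lift ord0 i) 0 = y i 0.
Proof. by rewrite mxE liftK. Qed.

Definition tail_col n (z : 'cV[R]_n.+1) : 'cV[R]_n := row' ord0 z.

Lemma tail_col_is_linear n : linear (@tail_col n).
Proof. by move=> a x y; apply/colP => i; rewrite !mxE. Qed.

HB.instance Definition _ n := GRing.isLinear.Build R 'cV[R]_n.+1 'cV[R]_n _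
  (@tail_col n) (@tail_col_is_linear n).

Lemma tail_col_cons n x (y : 'cV[R]_n) : tail_col (cons_col x y) = y.
Proof. by apply/colP => i; rewrite mxE cons_col_lift. Qed.

Lemma cons_col_tail n (z : 'cV[R]_n.+1) :
  z = cons_col (z ord0 0) (tail_col z).
Proof.
apply/colP => i; case: (unliftP ord0 i) => [j ->|->].
  by rewrite cons_col_lift mxE.
by rewrite cons_col0.
Qed.

Lemma cons_colD n x x' (y y' : 'cV[R]_n) :
  cons_col x y + cons_col x' y' = cons_col (x + x') (y + y').
Proof.
by apply/colP => i; rewrite !mxE; case: unliftP => // j; rewrite mxE.
Qed.

Lemma cons_colZ n a x (y : 'cV[R]_n) :
  a *: cons_col x y = cons_col (a * x) (a *: y).
Proof.
by apply/colP => i; rewrite !mxE; case: unliftP => // j; rewrite mxE.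
Qed.

Lemma tcol_cons n (p : TR * n.-tuple TR) :
  tcol (cons_pair p) = cons_col p.1 (tcol p.2).
Proof.
apply/colP => i; rewrite mxE; case: (unliftP ord0 i) => [j ->|->].
  by rewrite cons_col_lift mxE tnthS.
by rewrite cons_col0.
Qed.

Lemma cV_measurable_preimage m n (f : 'cV[R]_m -> 'cV[R]_n) (A : set 'cV[R]_n) :
  (forall i, measurable_fun [set: m.-tuple TR]
     (fun t => f (tcol t) i 0 : TR)) ->
  cV_measurable A -> cV_measurable (f @^-1` A).
Proof.
move=> mf mA.
pose g (t : m.-tuple TR) : n.-tuple TR := [tuple f (tcol t) i 0 | i < n].
have mg : measurable_fun setT g.
  apply/measurable_fun_tnthP => i; apply: eq_measurable_fun (mf i) => t _ /=.
  by rewrite tnth_mktuple.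
rewrite /cV_measurable (_ : [set t | _] = g @^-1` [set t | A (tcol t)]).
  by rewrite -[X in measurable X]setTI; exact: mg.
apply/seteqP; split=> t /=; rewrite (_ : tcol (g t) = f (tcol t))//;
  by apply/colP => i; rewrite mxE tnth_mktuple.
Qed.

Lemma cV_measurable_affine m n (M : 'M[R]_(n, m)) b (A : set 'cV[R]_n) :
  cV_measurable A -> cV_measurable [set x | A (M *m x + b)].
Proof.
apply: (@cV_measurable_preimage m n (fun x => M *m x + b)) => i.
under eq_fun do rewrite !mxE.
apply: measurable_funD => //; apply: measurable_sum => j.
apply: measurable_funM => //.
under eq_fun do rewrite mxE.
exact: measurable_tnth.
Qed.

Lemma cV_measurable_pair n (A : set 'cV[R]_n.+1) : cV_measurable A ->
  measurable [set p : TR * n.-tuple TR | A (cons_col p.1 (tcol p.2))].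
Proof.
move=> mA.
rewrite (_ : [set p | _] = @cons_pair R n @^-1` [set t | A (tcol t)]).
  by rewrite -[X in measurable X]setTI; exact: measurable_cons_pair.
by apply/seteqP; split=> p /=; rewrite tcol_cons.
Qed.

Lemma cV_measurable_fst n (A : set 'cV[R]_n.+1) y : cV_measurable A ->
  measurable [set x : TR | A (cons_col x (tcol y))].
Proof.
move=> /cV_measurable_pair/(measurable_ysection y).
by congr (measurable _); apply/seteqP; split=> x; rewrite /ysection/= inE.
Qed.

Lemma cV_measurable_snd n (A : set 'cV[R]_n.+1) x : cV_measurable A ->
  cV_measurable [set y | A (cons_col x y)].
Proof.
move=> /cV_measurable_pair/(measurable_xsection x).
by congr (measurable _); apply/seteqP; split=> y; rewrite /xsection/= inE.
Qed.

Lemma volumeS n (A : set 'cV[R]_n.+1) :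
  volume A = (@lebesgue_measure R \x @lebesgue_tuple R n)%E
    [set p : TR * n.-tuple TR | A (cons_col p.1 (tcol p.2))].
Proof.
rewrite /volume /=; congr (product_measure1 _ _ _).
by apply/seteqP; split=> p /=; rewrite -/(tcol (cons_pair p)) tcol_cons.
Qed.

Lemma volume_xsection n (A : set 'cV[R]_n.+1) :
  volume A = (\int[@lebesgue_measure R]_x volume [set y | A (cons_col x y)])%E.
Proof.
rewrite volumeS; apply: eq_integral => x _ /=.
by congr lebesgue_tuple; apply/seteqP; split=> y; rewrite /xsection/= inE.
Qed.

(** The measure [\x^], which integrates in the other order, agrees with [\x] on measurable
    rectangles, so the two coincide by uniqueness of the product measure. *)
Lemma volume_ysection n (A : set 'cV[R]_n.+1) : cV_measurable A ->
  volume A = (\int[@lebesgue_tuple R n]_t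
    lebesgue_measure [set x : TR | A (cons_col x (tcol t))])%E.
Proof.
move=> mA; rewrite volumeS.
pose P : {measure set (TR * n.-tuple TR)%type -> \bar R} :=
  (@lebesgue_measure R \x^ @lebesgue_tuple R n)%E.
rewrite (@product_measure_unique _ _ _ _ _ _ _ P).
- apply: eq_integral => t _ /=.
  by congr lebesgue_measure; apply/seteqP; split=> x; rewrite /ysection/= inE.
- by move=> B C mB mC; rewrite /P /= product_measure2E.
- exact: cV_measurable_pair.
Qed.

Lemma measurable_fun_fst_length n (A : set 'cV[R]_n.+1) : cV_measurable A ->
  measurable_fun [set: n.-tuple TR] (fun t =>
    lebesgue_measure [set x : TR | A (cons_col x (tcol t))]).
Proof.
move=> mA; have := measurable_fun_ysection (@lebesgue_measure R)
  (cV_measurable_pair mA).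
apply: eq_measurable_fun => t _ /=; congr lebesgue_measure.
by apply/seteqP; split=> x; rewrite /ysection/= inE.
Qed.

(** The pushforward under a translation agrees with Lebesgue measure on half-open intervals, hence
    on all Borel sets. *)
Lemma lebesgue_measure_shift (A : set TR) (c : R) : measurable A ->
  lebesgue_measure [set x | A (x + c)] = lebesgue_measure A.
Proof.
move=> mA; have mf : measurable_fun setT (fun x : TR => x + c : TR).
  exact: measurable_funD.
pose nu : {measure set TR -> \bar R} :=
  measure_function_pushforward__canonical__measure_function_Measure
    (@lebesgue_measure R) mf.
rewrite (@lebesgue_measure_unique R nu _ A mA)// => _ [[a b]] _ <-.
rewrite /nu /= /pushforward.
have -> : (fun x : TR => x + c) @^-1` `]a, b] =
    `]a - c, b - c]%classic :> set R.
  by apply/seteqP; split=> x /=; rewrite !in_itv/= lerBrDr ltrBlDr.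
by rewrite !lebesgue_measure_itv/= !lte_fin ltrD2r -!EFinB opprB addrA subrK.
Qed.

(** On each line parallel to the first axis the shear is a translation by [f y], which preserves the
    length of the fibre. *)
Lemma volume_shear_fst n (A B : set 'cV[R]_n.+1) (f : 'cV[R]_n -> R) :
  cV_measurable A -> cV_measurable B ->
  (forall x y, B (cons_col x y) <-> A (cons_col (x + f y) y)) ->
  volume B = volume A.
Proof.
move=> mA mB BA; rewrite !volume_ysection//; apply: eq_integral => t _.
rewrite -(@lebesgue_measure_shift _ (f (tcol t)) (cV_measurable_fst t mA)).
by congr lebesgue_measure; apply/seteqP; split=> x /BA.
Qed.

Lemma volume_shift n (A : set 'cV[R]_n) b : cV_measurable A ->
  volume [set x | A (x + b)] = volume A.
Proof.
elim: n A b => [|n IH] A b mA.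
  congr volume.
  by apply/seteqP; split=> x /=; rewrite [x + b]flatmx0 [x]flatmx0.
have mS c : cV_measurable [set x | A (x + c)].
  by have := cV_measurable_affine 1%:M c mA; under eq_set do rewrite mul1mx.
rewrite [b]cons_col_tail; set b0 := b _ _; set b' := tail_col b.
(* The translation splits into a shear by the constant [b0] along the first axis and a translation
   of the tail, which the inductive hypothesis handles section by section. *)
rewrite (@volume_shear_fst _ [set x | A (x + cons_col 0 b')] _ (fun=> b0))//.
  rewrite volume_xsection [RHS]volume_xsection; apply: eq_integral => x _.
  rewrite -(IH _ b' (cV_measurable_snd x mA)); congr volume.
  by apply/seteqP; split=> y /=; rewrite cons_colD addr0.
by move=> x y /=; rewrite !cons_colD addr0.
Qed.

(** The sections at fixed [x] are translates of each other by [g x]. *)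
Lemma volume_shear_snd n (A B : set 'cV[R]_n.+1) (g : R -> 'cV[R]_n) :
  cV_measurable A ->
  (forall x y, B (cons_col x y) <-> A (cons_col x (y + g x))) ->
  volume B = volume A.
Proof.
move=> mA BA; rewrite !volume_xsection; apply: eq_integral => x _.
rewrite -(volume_shift (g x) (cV_measurable_snd x mA)).
by congr volume; apply/seteqP; split=> y /BA.
Qed.

End volume_theory.

(** * Volume of zonotopes *)

Section zono.
Variable R : realType.
Local Notation TR := (measurableTypeR R).

(** The zonotope as an iterated Minkowski sum of segments; the list form permits induction on the
    number of generators. *)
Fixpoint zono n (vs : seq 'cV[R]_n) : set 'cV[R]_n :=
  if vs is v :: vs' then
    [set x | exists2 c, 0 <= c <= 1 & zono vs' (x - c *: v)]
  else [set 0].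

Lemma zono_neq0 n (vs : seq 'cV[R]_n) : zono vs !=set0.
Proof.
elim: vs => [|v vs [x zx]] /=; first by exists 0.
by exists x, 0; rewrite ?lexx ?ler01// scale0r subr0.
Qed.

Lemma zono_map m n (f : {linear 'cV[R]_m -> 'cV[R]_n}) vs :
  zono (map f vs) = f @` zono vs.
Proof.
elim: vs => [|v vs IH] /=; first by rewrite image_set1 linear0.
apply/seteqP; split=> [y [c c01]|_ [x [c c01 zx] <-]].
  rewrite IH => -[x zx fx]; exists (x + c *: v).
    by exists c => //; rewrite addrK.
  by rewrite linearD linearZ /= fx subrK.
exists c => //; rewrite IH; exists (x - c *: v) => //.
by rewrite linearB linearZ.
Qed.

Lemma zono_inj m n (f : {linear 'cV[R]_m -> 'cV[R]_n}) vs x : injective f ->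
  zono (map f vs) (f x) <-> zono vs x.
Proof.
move=> fI; rewrite zono_map; split=> [[z zz /fI<-]//|zx].
by exists x.
Qed.

Lemma zono_convex n (vs : seq 'cV[R]_n) x y t : 0 <= t <= 1 ->
  zono vs x -> zono vs y -> zono vs (t *: x + (1 - t) *: y).
Proof.
move=> /andP[t0 t1]; elim: vs x y => [|v vs IH] x y /=.
  by move=> -> ->; rewrite !scaler0 addr0.
move=> [c /andP[c0 c1] zx] [d /andP[d0 d1] zy].
exists (t * c + (1 - t) * d); last first.
  have := IH _ _ zx zy; congr (zono vs _).
  by apply/colP => i; rewrite !mxE; ring.
have t'0 : 0 <= 1 - t by rewrite subr_ge0.
apply/andP; split; first by rewrite addr_ge0// mulr_ge0.
rewrite -[leRHS](subrKC t) lerD//; first by rewrite ler_piMr.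
by rewrite ler_piMr.
Qed.

Lemma zono_bounded n (vs : seq 'cV[R]_n) i :
  exists M, forall x, zono vs x -> `|x i 0| <= M.
Proof.
elim: vs => [|v vs [M IH]] /=; first by exists 0 => x ->; rewrite mxE normr0.
exists (M + `|v i 0|) => x [c /andP[c0 c1] /IH]; rewrite !mxE => h.
rewrite -[x i 0](subrK (c * v i 0)) (le_trans (ler_normD _ _))// lerD//.
by rewrite normrM ger0_norm// ler_piMl.
Qed.

(** Topological closedness for the sup norm, written coordinatewise. *)
Definition cV_closed n (A : set 'cV[R]_n) : Prop :=
  forall x : 'cV[R]_n, (forall e, 0 < e ->
    exists2 a : 'cV[R]_n, A a & forall i, `|x i 0 - a i 0| < e) -> A x.

(* The coefficient of [v] is obtained as a cluster point, in the compact unit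
   interval, of the coefficients of a sequence of approximations. *)
Lemma zono_closed n (vs : seq 'cV[R]_n) : cV_closed (zono vs).
Proof.
elim: vs => [|v vs IH] x /= xP.
  apply/colP => i; rewrite mxE; apply/eqP; rewrite -normr_le0.
  apply/ler_addgt0Pl => e e0; rewrite addr0.
  by have [_ -> /(_ i)] := xP _ e0; rewrite mxE subr0 => /ltW.
have /choice[c cP] : forall k : nat, exists c : R, 0 <= c <= 1 /\
    exists2 a, zono vs a & forall i, `|x i 0 - c * v i 0 - a i 0| < k.+1%:R^-1.
  move=> k; have k0 : 0 < k.+1%:R^-1 :> R by rewrite invr_gt0 ltr0n.
  have [a [c c01 za] xa] := xP _ k0; exists c; split=> //.
  exists (a - c *: v) => // i; rewrite !mxE; have := xa i.
  by congr (`|_| < _); ring.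
have [l lI lc] : exists2 l : R, 0 <= l <= 1 & cluster (c @ \oo) l.
  have cI : (c @ \oo) `[0, 1]%classic.
    by exists 0%N => // k _ /=; rewrite in_itv/=; case: (cP k).
  have [l [lI lc]] := @segment_compact R 0 1 (c @ \oo) _ cI.
  by exists l => //; move: lI; rewrite /= in_itv.
exists l => //; apply: IH => e e0.
have [M M0 vM] : exists2 M, 0 < M & forall i, `|v i 0| <= M.
  (* The summand 1 makes the bound positive, so that [e / 2] can be divided by it. *)
  exists (1 + \sum_i `|v i 0|).
    by rewrite ltr_wpDr// sumr_ge0.
  move=> i; rewrite (bigD1 i)//= addrCA lerDl addr_ge0// sumr_ge0//.
have e2M : 0 < e / 2 / M by rewrite !divr_gt0.
have e2 : 0 < e / 2 by rewrite divr_gt0.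
have [K _ KP] := near_infty_natSinv_lt (PosNum e2).
have cK : (c @ \oo) (c @` [set k | (K <= k)%N]).
  by exists K => // k /= Kk; exists k.
(* The cluster point [l] is within [e / 2 / M] of some [c k] with [k >= K]; replacing [c k] by [l]
   and the [k]-th approximation then each cost at most [e / 2]. *)
have [_ [/= [k Kk <-] lk]] := lc _ _ cK (nbhsx_ballx l _ e2M).
have [_ [a za xa]] := cP k; exists a => // i.
rewrite !mxE (_ : _ - _ = (x i 0 - c k * v i 0 - a i 0) + (c k - l) * v i 0).
  rewrite (le_lt_trans (ler_normD _ _))// [e]splitr ltrD//.
    by apply: lt_trans (xa i) _; exact: KP.
  move: lk; rewrite /ball/= distrC normrM ltr_pdivlMr//; apply: le_lt_trans.
  by rewrite ler_wpM2l.
by ring.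
Qed.

End zono.

(** * Fibres of a zonotope and its volume as a sum of determinants *)

Section zonotope_volume.
Variable R : realType.
Local Notation TR := (measurableTypeR R).

(** A closed set is the intersection over [k] of the countable unions of boxes of radius
    [1 / (k + 1)] whose rational centres are that close to the set. *)
Lemma cV_closed_measurable n (A : set 'cV[R]_n) :
  cV_closed A -> cV_measurable A.
Proof.
move=> cA; pose box (k : nat) (q : {ffun 'I_n -> rat}) : set (n.-tuple TR) :=
  [set t | (exists2 a : 'cV[R]_n, A a &
              forall i, `|ratr (q i) - a i 0| < k.+1%:R^-1) /\
           forall i, `|tnth t i - ratr (q i)| < k.+1%:R^-1].
rewrite /cV_measurable (_ : [set t | _] = \bigcap_k \bigcup_q box k q).
  apply: bigcapT_measurable => k; apply: countable_bigcupT_measurable => // q.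
  rewrite /box; have [Aq|nAq] := pselect (exists2 a : 'cV[R]_n, A a &
      forall i, `|ratr (q i) - a i 0| < k.+1%:R^-1); last first.
    by rewrite (_ : [set t | _] = set0)// -subset0 => t [].
  rewrite (_ : [set t | _] = \bigcap_(i in [set: 'I_n])
      ((@tnth n TR)^~ i @^-1` ball (ratr (q i) : R) k.+1%:R^-1)).
    apply: fin_bigcap_measurable => // i _.
    rewrite -[X in measurable X]setTI; apply: measurable_tnth => //.
    exact: measurable_ball.
  apply/seteqP; split=> t /= => [[_ tq] i _|tq].
    by rewrite /ball/= distrC.
  by split=> // i; rewrite distrC; exact: tq.
apply/seteqP; split=> t /= At.
  move=> k _; have k0 : 0 < k.+1%:R^-1 :> R by rewrite invr_gt0 ltr0n.
  have /choice[q qt] : forall i, exists q : rat,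
      `|tnth t i - ratr q| < k.+1%:R^-1 :> R.
    move=> i; have lt_t : tnth t i < tnth t i + k.+1%:R^-1 by rewrite ltrDl.
    have [q] := rat_in_itvoo lt_t; rewrite in_itv/= => /andP[tq qt].
    by exists q; rewrite distrC gtr0_norm ?subr_gt0// ltrBlDl.
  exists (finfun q) => //; split=> [|i]; last by rewrite ffunE.
  by exists (tcol t) => // i; rewrite ffunE mxE distrC.
apply: cA => e e0; have e2 : 0 < e / 2 by rewrite divr_gt0.
(* With radius below [e / 2], the rational centre links the point to [a] within [e]. *)
have [K _ /(_ K (leqnn K)) Ke] := near_infty_natSinv_lt (PosNum e2).
have [q _ [[a Aa qa] tq]] := At K I; exists a => // i.
rewrite mxE -[X in `|X|](subrKA (ratr (q i))) (le_lt_trans (ler_normD _ _))//.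
by rewrite [e]splitr ltrD// (lt_trans _ Ke).
Qed.

Lemma zono_measurable n (vs : seq 'cV[R]_n) : cV_measurable (zono vs).
Proof. by apply: cV_closed_measurable; exact: zono_closed. Qed.

(** The infimum and supremum belong to [I] because it is closed, and convexity fills the space
    between them. *)
Lemma compact_interval (I : set R) : I !=set0 ->
  (exists M, forall x, I x -> `|x| <= M) ->
  (forall x, (forall e, 0 < e -> exists2 a, I a & `|x - a| < e) -> I x) ->
  (forall x y t, 0 <= t <= 1 -> I x -> I y -> I (t * x + (1 - t) * y)) ->
  exists l u, l <= u /\ I = `[l, u]%classic.
Proof.
move=> I0 [M IM] Icl Icvx.
have hasub : has_ubound I by exists M => x /IM; exact: le_trans (ler_norm _).
have haslb : has_lbound I.
  by exists (- M) => x /IM; rewrite ler_norml => /andP[].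
have Isup : I (sup I).
  apply: Icl => e e0; have [a Ia ea] := sup_adherent e0 (conj I0 hasub).
  exists a => //; rewrite ger0_norm ?subr_ge0 ?ub_le_sup//.
  by rewrite ltrBlDr -ltrBlDl.
have Iinf : I (inf I).
  apply: Icl => e e0; have [a Ia ea] := inf_adherent e0 (conj I0 haslb).
  exists a => //; rewrite distrC ger0_norm ?subr_ge0 ?ge_inf//.
  by rewrite ltrBlDl.
have le_lu : inf I <= sup I by exact: ub_le_sup.
exists (inf I), (sup I); split=> //.
apply/seteqP; split=> x /=; rewrite in_itv/=.
  by move=> Ix; rewrite ge_inf//= ub_le_sup.
move=> /andP[lx xu]; move: le_lu; rewrite le_eqVlt => /orP[/eqP e|lt_lu].
  by rewrite (_ : x = inf I)//; apply/eqP; rewrite eq_le lx e xu.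
have d0 : 0 < sup I - inf I by rewrite subr_gt0.
(* The barycentric coordinate of [x]; the case of equal endpoints was treated first because of this
   division. *)
pose t := (sup I - x) / (sup I - inf I).
have -> : x = t * inf I + (1 - t) * sup I.
  by rewrite /t; field; rewrite gt_eqF.
apply: Icvx => //; rewrite /t ler_pdivlMr// ler_pdivrMr// mul0r mul1r.
by rewrite subr_ge0 xu lerD2l lerN2.
Qed.

Lemma lebesgue_measure_extend (l u a : R) : l <= u ->
  lebesgue_measure
    [set x | exists2 c, 0 <= c <= 1 & `[l, u]%classic (x - c * a)] =
  (u - l + `|a|)%:E.
Proof.
move=> lu.
rewrite (_ : [set x | _] = `[l + Num.min a 0, u + Num.max a 0]%classic).
  rewrite lebesgue_measure_itv/= lte_fin.
  have -> : `|a| = Num.max a 0 - Num.min a 0.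
    case: (leP 0 a) => a0; first by rewrite ger0_norm// subr0.
    by rewrite ltr0_norm// sub0r.
  have m0 : Num.min a 0 <= Num.max a 0.
    by rewrite ge_min !le_max !lexx.
  case: ltP => [_|ul]; first by rewrite -EFinB; congr (_%:E); ring.
  (* A degenerate interval forces [l = u] and [a = 0], so both sides vanish. *)
  by congr (_%:E); apply/eqP; lra.
apply/seteqP; split=> x /=; rewrite in_itv/=.
  move=> [c /andP[c0 c1]]; rewrite in_itv/= => /andP[].
  by case: (leP 0 a) => a0 h1 h2; apply/andP; split; nra.
(* Points of [[l, u]] use [c = 0]; any other point uses the coefficient that brings it back to the
   endpoint it passed. *)
move=> /andP[lx xu]; case: (leP x u) => [xu'|ux].
  case: (leP l x) => [lx'|xl].
    by exists 0; rewrite ?lexx ?ler01// mul0r subr0 in_itv/= lx'.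
  have a0 : a < 0.
    by rewrite ltNge; apply/negP => a0; move: lx; rewrite min_r//; lra.
  rewrite min_l in lx; last exact: ltW.
  exists ((x - l) / a); last by rewrite divfK ?lt_eqF// in_itv/=; lra.
  by rewrite ler_ndivlMr// ler_ndivrMr// mul0r mul1r; lra.
have a0 : 0 < a.
  by rewrite ltNge; apply/negP => a0; move: xu; rewrite max_r//; lra.
rewrite max_l in xu; last exact: ltW.
exists ((x - u) / a); last by rewrite divfK ?gt_eqF// in_itv/=; lra.
by rewrite ler_pdivlMr// ler_pdivrMr// mul0r mul1r; lra.
Qed.

(** Projecting the generators projects the zonotope, so membership of [y] decides whether the fibre
    over [y] is nonempty. *)
Lemma zono_tail n (vs : seq 'cV[R]_n.+1) y :
  zono (map (@tail_col R n) vs) y <-> exists x, zono vs (cons_col x y).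
Proof.
rewrite zono_map; split=> [[z zz <-]|[x zx]].
  by exists (z ord0 0); rewrite -cons_col_tail.
by exists (cons_col x y) => //; exact: tail_col_cons.
Qed.

Lemma zono_fiber_length n a (vs : seq 'cV[R]_n.+1) y :
  lebesgue_measure [set x | zono (cons_col a 0 :: vs) (cons_col x y)] =
  (lebesgue_measure [set x | zono vs (cons_col x y)] +
   `|a|%:E * (\1_(zono (map (@tail_col R n) vs)) y)%:E)%E.
Proof.
set I := [set x | zono vs (cons_col x y)].
rewrite (_ : [set x | _] = [set x | exists2 c, 0 <= c <= 1 & I (x - c * a)]).
  (* An empty fibre stays empty after adding a segment, and there the indicator is 0. *)
  have [nI|/set0P I0] := eqVneq I set0.
    rewrite nI measure0 add0e indicE memNset ?mule0; last first.
      by rewrite zono_tail => -[x zx]; rewrite -[False]/(@set0 R x) -nI.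
    by rewrite (_ : [set x | _] = set0) ?measure0// -subset0 => x [c _].
  have [l [u [lu Ilu]]] : exists l u, l <= u /\ I = `[l, u]%classic.
    apply: compact_interval => //.
    - have [M zM] := zono_bounded vs ord0; exists M => x /zM.
      by rewrite cons_col0.
    - move=> x xP; apply: zono_closed => e e0; have [b Ib xb] := xP _ e0.
      exists (cons_col b y) => // i; case: (unliftP ord0 i) => [j ->|->].
        by rewrite !cons_col_lift subrr normr0.
      by rewrite !cons_col0.
    - move=> x z t t01 Ix Iz; have := zono_convex t01 Ix Iz.
      by rewrite !cons_colZ cons_colD -scalerDl subrKC scale1r.
  rewrite Ilu lebesgue_measure_extend// indicE mem_set ?mule1; last first.
    by rewrite zono_tail; case: I0 => x Ix; exists x.
  rewrite lebesgue_measure_itv/= lte_fin EFinD; congr (_ + _)%E.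
  by case: ltgtP lu => // -> _; rewrite subrr.
have E x c : cons_col x y - c *: cons_col a 0 = cons_col (x - c * a) y.
  apply/colP => i; rewrite !mxE; case: unliftP => [j _|//].
  by rewrite mxE mulr0 subr0.
by apply/seteqP; split=> x /= [c c01 zx]; exists c => //; move: zx;
  rewrite /I/= E.
Qed.

Lemma volume_zono_cons n a (vs : seq 'cV[R]_n.+1) :
  volume (zono (cons_col a 0 :: vs)) =
  (volume (zono vs) + `|a|%:E * volume (zono (map (@tail_col R n) vs)))%E.
Proof.
rewrite !volume_ysection; try exact: zono_measurable.
under eq_integral do rewrite zono_fiber_length.
have mT : measurable
    [set t : n.-tuple TR | zono (map (@tail_col R n) vs) (tcol t)].
  exact: zono_measurable.
have mf : measurable_fun [set: n.-tuple TR] (fun t =>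
    (\1_(zono (map (@tail_col R n) vs)) (tcol t) : R)%:E).
  by apply/measurable_EFinP; exact: (measurable_indic mT).
rewrite ge0_integralD//=.
- congr (_ + _)%E; rewrite ge0_integralZl_EFin//.
  congr (_ * _)%E.
  have := integral_indic (@lebesgue_tuple R n) measurableT mT.
  by rewrite setIT.
- by apply: measurable_fun_fst_length; exact: zono_measurable.
- exact: measurable_funeM.
Qed.

Lemma cons_colE n x (y : 'cV[R]_n) :
  cons_col x y = col_mx (x%:M : 'M[R]_1) y :> 'cV[R]_(1 + n).
Proof.
apply/colP => i; case: (unliftP ord0 i) => [j ->|->].
  rewrite cons_col_lift -(col_mxEd (x%:M : 'M[R]_1) y j 0).
  by congr (fun_of_matrix (col_mx _ _) _ _); exact: val_inj.
have := col_mxEu (x%:M : 'M[R]_1) y 0 0; rewrite [RHS]mxE eqxx mulr1n => e.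
rewrite cons_col0 -[LHS]e.
by congr (fun_of_matrix (col_mx _ _) _ _); exact: val_inj.
Qed.

Definition shear_snd n (l : 'cV[R]_n) : 'M[R]_n.+1 :=
  block_mx (1%:M : 'M[R]_1) 0 l 1%:M.

Definition shear_fst n (w : 'rV[R]_n) : 'M[R]_n.+1 :=
  block_mx (1%:M : 'M[R]_1) w 0 1%:M.

Lemma det_shear_snd n (l : 'cV[R]_n) : \det (shear_snd l) = 1.
Proof. by rewrite (det_lblock (1%:M : 'M[R]_1)) !det1 mulr1. Qed.

Lemma det_shear_fst n (w : 'rV[R]_n) : \det (shear_fst w) = 1.
Proof. by rewrite (det_ublock (1%:M : 'M[R]_1)) !det1 mulr1. Qed.

Lemma mul_shear_snd n (l : 'cV[R]_n) x y :
  shear_snd l *m cons_col x y = cons_col x (y + x *: l).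
Proof.
rewrite /shear_snd !cons_colE (mul_block_col (1%:M : 'M[R]_1)).
by rewrite mul1mx mul0mx addr0 mul1mx mul_mx_scalar addrC.
Qed.

Lemma mul_shear_fst n (w : 'rV[R]_n) x y :
  shear_fst w *m cons_col x y = cons_col (x + (w *m y) 0 0) y.
Proof.
rewrite /shear_fst !cons_colE (mul_block_col (1%:M : 'M[R]_1)).
by rewrite !mul1mx mul0mx add0r [in RHS]raddfD/= -mx11_scalar.
Qed.

Lemma mulmx_inj n (T : 'M[R]_n) : \det T = 1 ->
  injective (mulmx T : 'cV[R]_n -> 'cV[R]_n).
Proof. by move=> dT; apply/can_inj/mulKmx; rewrite unitmxE dT unitr1. Qed.

Lemma volume_shear_zono_snd n (l : 'cV[R]_n) (vs : seq 'cV[R]_n.+1) :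
  volume (zono (map (mulmx (shear_snd l)) vs)) = volume (zono vs).
Proof.
apply/esym; apply: (volume_shear_snd (g := fun x => x *: l)).
  exact: zono_measurable.
move=> x y; rewrite -mul_shear_snd.
rewrite (@zono_inj _ _ _ (mulmx (shear_snd l)))//.
exact/mulmx_inj/det_shear_snd.
Qed.

Lemma volume_shear_zono_fst n (w : 'rV[R]_n) (vs : seq 'cV[R]_n.+1) :
  volume (zono (map (mulmx (shear_fst w)) vs)) = volume (zono vs).
Proof.
apply/esym; apply: (volume_shear_fst (f := fun y => (w *m y) 0 0));
  try exact: zono_measurable.
move=> x y; rewrite -mul_shear_fst.
rewrite (@zono_inj _ _ _ (mulmx (shear_fst w)))//.
exact/mulmx_inj/det_shear_fst.
Qed.

(** If the first coordinate is nonzero, one shear clears the others. If it is zero, a shear first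
    copies a nonzero entry of the tail into it; the zero vector is already on the axis. *)
Lemma shear_to_axis n (v : 'cV[R]_n.+1) : exists T : 'M[R]_n.+1,
  [/\ \det T = 1, exists a, T *m v = cons_col a 0 &
      forall vs, volume (zono (map (mulmx T) vs)) = volume (zono vs)].
Proof.
have reduce (u : 'cV[R]_n.+1) : u ord0 0 != 0 -> exists T : 'M[R]_n.+1,
    [/\ \det T = 1, exists a, T *m u = cons_col a 0 &
        forall vs, volume (zono (map (mulmx T) vs)) = volume (zono vs)].
  move=> u0; exists (shear_snd (- (u ord0 0)^-1 *: tail_col u)); split.
  - exact: det_shear_snd.
  - exists (u ord0 0); rewrite [u in _ *m u]cons_col_tail mul_shear_snd.
    by rewrite scalerA mulrN mulfV// scaleN1r subrr.
  - exact: volume_shear_zono_snd.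
have [v0|/reduce//] := eqVneq (v ord0 0) 0.
have [v'0|] := eqVneq (tail_col v) 0.
  exists 1%:M; split=> [||vs]; first exact: det1.
    by exists 0; rewrite mul1mx [v]cons_col_tail v0 v'0.
  by congr (volume (zono _)); rewrite -[RHS]map_id; apply: eq_map => u;
    rewrite mul1mx.
move=> /eqP v'0; have [i vi] : exists i, tail_col v i 0 != 0.
  apply: contrapT => h; apply: v'0; apply/colP => i; rewrite [RHS]mxE.
  by apply/eqP/negPn/negP => vi; apply: h; exists i.
have uE : shear_fst (delta_mx 0 i) *m v =
    cons_col (tail_col v i 0) (tail_col v).
  by rewrite [v in _ *m v]cons_col_tail mul_shear_fst v0 add0r -rowE mxE.
have [|T [dT Tu Tvol]] := reduce (shear_fst (delta_mx 0 i) *m v).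
  by rewrite uE cons_col0.
exists (T *m shear_fst (delta_mx 0 i)); split=> [||vs].
- by rewrite det_mulmx dT det_shear_fst mulr1.
- by rewrite -mulmxA.
- rewrite -[RHS](volume_shear_zono_fst (delta_mx 0 i)) -[RHS]Tvol.
  by rewrite -map_comp; congr (volume (zono _)); apply: eq_map => u /=;
    rewrite mulmxA.
Qed.

Definition cols_mx n (w : seq 'cV[R]_n) : 'M[R]_n :=
  \matrix_(i, j) (nth 0 w j) i 0.

Lemma det_cols_mulmx n (T : 'M[R]_n) w : size w = n ->
  \det (cols_mx (map (mulmx T) w)) = \det T * \det (cols_mx w).
Proof.
move=> wn; rewrite -det_mulmx; congr (\det _); apply/matrixP => i j.
rewrite mxE (nth_map 0) ?wn// !mxE; apply: eq_bigr => k _.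
by rewrite mxE.
Qed.

(** The last column has a single nonzero candidate, [a] in the top row; the absolute value absorbs
    the cofactor sign. *)
Lemma det_cols_rcons n a (w : seq 'cV[R]_n.+1) : size w = n ->
  `|\det (cols_mx (rcons w (cons_col a 0)))| =
  `|a| * `|\det (cols_mx (map (@tail_col R n) w))|.
Proof.
move=> wn; rewrite (expand_det_col _ ord_max) big_ord_recl big1 => [|i _].
  rewrite addr0 mxE nth_rcons wn ltnn eqxx cons_col0 !normrM normrX normrN1.
  rewrite expr1n mul1r; congr (_ * `|\det _|); apply/matrixP => i j.
  by rewrite !mxE (nth_map 0) ?wn// mxE nth_rcons lift_max wn ltn_ord.
by rewrite mxE nth_rcons wn ltnn eqxx cons_col_lift mxE mul0r.
Qed.

Theorem volume_zonoE n (vs : seq 'cV[R]_n) :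
  volume (zono vs) = (subsum n vs (fun w => `|\det (cols_mx w)|))%:E.
Proof.
(* The dimension stays general because the projected generators live one dimension lower. *)
have [m] := ubnP (size vs); elim: m n vs => // m IH [|n] vs.
  move=> _; rewrite subsum0 det_mx00 normr1 /volume/= diracE mem_set//=.
  by have [x] := zono_neq0 vs; rewrite [x]flatmx0 [\col__ _]flatmx0.
case: vs => [_|v vs vs_m].
  rewrite /volume (_ : [set t | _] = [set t | forall i, [set 0] (tnth t i)]).
    rewrite (lebesgue_tuple_box (A := fun=> [set 0]))//.
    by rewrite big_ord_recl lebesgue_measure_set1 mul0e.
  apply/seteqP; split=> t /=.
    by move=> /colP t0 i; have := t0 i; rewrite !mxE.
  by move=> t0; apply/colP => i; rewrite !mxE t0.
have [T [dT [a Tv] Tvol]] := shear_to_axis v.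
(* All generators are sheared by [T], the first is split off along the axis, and [Tvol] then undoes
   the shear on the rest. *)
rewrite -Tvol [map _ _]/= Tv volume_zono_cons Tvol !IH ?size_map//=.
rewrite -EFinM -EFinD.
congr (_ + _)%:E.
rewrite -map_comp subsum_map -subsumZ; apply: eq_subsum_size => w wn /=.
rewrite map_comp -det_cols_rcons ?size_map// -Tv -map_rcons.
by rewrite det_cols_mulmx ?dT ?mul1r// size_rcons wn.
Qed.

End zonotope_volume.

(** * The zonotope generated by the pair *)

Section reachability_zonotope.
Variable R : realType.

Lemma zono_iota n (g : nat -> 'cV[R]_n) N :
  zono (map g (rev (iota 0 N))) =
  [set x | exists2 c : nat -> R, (forall i, (i < N)%N -> 0 <= c i <= 1) &
           x = \sum_(i < N) c i *: g i].
Proof.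
elim: N => [|N IH].
  apply/seteqP; split=> x /= => [->|[c _ ->]]; last by rewrite big_ord0.
  by exists (fun=> 0) => //; rewrite big_ord0.
rewrite rev_iota0S /= IH; apply/seteqP; split=> x /=.
  move=> [a a01 [c c01 xc]]; exists (fun i => if i == N then a else c i).
    by move=> i; rewrite ltnS leq_eqVlt; case: eqVneq => //= _; exact: c01.
  rewrite big_ord_recr /= eqxx -[LHS](subrK (a *: g N)) xc; congr (_ + _).
  by apply: eq_bigr => i _; rewrite ltn_eqF.
move=> [c c01 ->]; exists (c N); first exact: c01.
exists c => [i iN|]; first by rewrite c01// ltnW.
by rewrite big_ord_recr /= addrK.
Qed.

Lemma zonotope_zono n N (P : 'M[R]_(n, N)) (g : nat -> 'cV[R]_n) :
  (forall k : 'I_N, col k P = g k) ->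
  zonotope P = zono (map g (rev (iota 0 N))).
Proof.
move=> Pg; rewrite zono_iota; apply/seteqP; split=> x /= [c c01 ->].
  exists (fun i => if insub i is Some j then c j else 0).
    by move=> i iN; rewrite insubT.
  by apply: eq_bigr => i _; rewrite valK Pg.
exists c => [i|]; first exact: c01.
by apply: eq_bigr => i _; rewrite Pg.
Qed.

Lemma diag_mx_exp_mul n (lam : 'rV[R]_n) (G : 'cV[R]_n) k i :
  (diag_mx lam ^+ k *m G) i 0 = lam 0 i ^+ k * G i 0.
Proof.
elim: k => [|k IH]; first by rewrite !expr0 mul1r mul1mx.
by rewrite !exprS -mulmxE -mulmxA mul_diag_mx mxE IH mulrA.
Qed.

(** The matrix factors as the diagonal matrix of [G] times the generalized Vandermonde matrix. *)
Lemma det_cols_diag n (lam : 'rV[R]_n) (G : 'cV[R]_n) (w : seq nat) :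
  size w = n ->
  \det (cols_mx [seq diag_mx lam ^+ k *m G | k <- w]) =
  (\prod_i G i 0) * Fdet lam (nth 0%N w).
Proof.
move=> wn; rewrite (_ : \prod_i _ = \det (diag_mx G^T)); last first.
  by rewrite det_diag; apply: eq_bigr => i _; rewrite mxE.
rewrite -det_mulmx; congr (\det _); apply/matrixP => i j.
rewrite mul_diag_mx !mxE (nth_map 0%N) ?wn//.
by rewrite diag_mx_exp_mul mulrC.
Qed.

Lemma volume_reachability n (lam : 'rV[R]_n) (G : 'cV[R]_n) N :
  (forall i, 0 < lam 0 i) ->
  (forall i j : 'I_n, (i < j)%N -> lam 0 i < lam 0 j) ->
  volume (zonotope (reachability_mx (diag_mx lam) G N)) =
  (`|\prod_(i < n) G i 0| * Vsum N lam)%:E.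
Proof.
move=> lam0 ilam.
rewrite (@zonotope_zono _ _ _ (fun k => diag_mx lam ^+ k *m G)).
  rewrite volume_zonoE subsum_map VsumE -subsumZ; congr (_%:E).
  apply: eq_subsum_iota => w wn ws /=.
  (* Positivity of [Fdet] on increasing exponents removes its absolute value. *)
  rewrite det_cols_diag// normrM [`|Fdet _ _|]gtr0_norm//.
  apply: Fdet_gt0 => // a b /andP[ab bn].
  by apply: (sorted_ltn_nth ltn_trans) => //; rewrite inE wn// (ltn_trans ab).
by move=> k; apply/colP => i; rewrite !mxE.
Qed.

End reachability_zonotope.

(** * Correctness and cost of the program *)

Section Vseq_theory.
Variable R : realType.

(** Node lists let nodes be deleted without changing the type. *)
Definition Vseq m (s : seq R) : R := Vsum m (\row_(a < size s) s`_a).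

Lemma VsumEseq m p (mu : 'rV[R]_p) s : p = size s ->
  (forall a : 'I_p, mu 0 a = s`_a) -> Vsum m mu = Vseq m s.
Proof.
move=> ps; subst p => mus; congr Vsum.
by apply/rowP => a; rewrite mus mxE.
Qed.

Lemma Vseq_rec m (s : seq R) : Vseq m.+1 s = Vseq m s +
  \sum_(i < size s) (-1) ^+ (size s + i.+1) * s`_i ^+ m *
                    Vseq m (take i s ++ drop i.+1 s).
Proof.
rewrite /Vseq Vsum_rec; congr (_ + _); apply: eq_bigr => i _.
rewrite mxE; congr (_ * _); apply: VsumEseq => [|a].
  rewrite size_cat size_take size_drop ltn_ord /=.
  by have := ltn_ord i; lia.
(* [col'] skips index [i] through [bump], matching the jump from [take i] to [drop i.+1]. *)
rewrite !mxE nth_cat size_take ltn_ord /= /bump.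
case: leqP => ia; rewrite ?add0n ?add1n.
  by rewrite nth_drop; congr (s`_ _); lia.
by rewrite nth_take.
Qed.

End Vseq_theory.

(** * The quantities indexed by subsets of the nodes *)

Section subset_volume.
Variables (R : realType) (n : nat) (lam : 'rV[R]_n).
Implicit Types (J : {set 'I_n}) (j : 'I_n).

(** The value that the register [Val J m] is meant to hold. *)
Definition Vset J m : R := Vseq m [seq lam 0 j | j <- enum J].

Lemma Vset0 J : Vset J 0 = (J == finset.set0)%:R.
Proof.
rewrite /Vset /Vseq; case: eqVneq => [->|/set0Pn[j jJ]].
  rewrite enum_set0 /=; exact: Vsum_dim0.
have : (0 < size [seq lam 0%R j | j <- enum J])%N.
  by rewrite size_map -cardE; apply/card_gt0P; exists j.
by case: [seq _ | _ <- _] => //= x s _; exact: Vsum_empty.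
Qed.

Lemma VsetT m : Vset [set: 'I_n]%SET m = Vsum m lam.
Proof.
apply/esym/VsumEseq => [|a]; first by rewrite size_map -cardE cardsT card_ord.
rewrite (nth_map a) ?size_enum; last by rewrite -cardE cardsT card_ord.
by rewrite enum_setT -enumT nth_ord_enum.
Qed.

Lemma enum_sorted J : sorted (relpre val ltn) (enum J).
Proof.
rewrite /enum_mem sorted_filter//; first by move=> ? ? ?; exact: ltn_trans.
by rewrite -enumT -sorted_map val_enum_ord iota_ltn_sorted.
Qed.

(** The enumeration of [J] is increasing, so the elements up to [j] are exactly those listed no
    later than [j]. *)
Lemma position_index J j : j \in J -> position J j = (index j (enum J)).+1.
Proof.
move=> jJ; have je : j \in enum J by rewrite mem_enum.
have tr : transitive (relpre (@nat_of_ord n) ltn).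
  by move=> ? ? ?; exact: ltn_trans.
have -> : position J j = count (fun i : 'I_n => i <= j)%N (enum J).
  rewrite /position cardE -size_filter /enum_mem -filter_predI; congr size.
  by apply: eq_filter => i; rewrite /= !inE andbC.
have := enum_sorted J; have := enum_uniq J.
case/splitPr: je => p1 p2.
rewrite (sorted_pairwise tr) pairwise_cat cat_uniq /=.
move=> /and3P[_ /norP[jp1 _] _] /and3P[p1j _ /andP[jp2 _]].
rewrite index_cat (negPf jp1) /= eqxx addn0 count_cat /= leqnn.
rewrite (_ : count _ p1 = size p1); last first.
  apply/eqP; rewrite -all_count; apply/allP => i ip1.
  by have /allrelP/(_ i j ip1) := p1j; rewrite inE eqxx => /(_ isT)/ltnW.
rewrite (_ : count _ p2 = 0%N) ?addn1//; apply/eqP.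
rewrite -leqn0 leqNgt -has_count; apply/hasPn => i ip2.
by rewrite -ltnNge; exact: (allP jp2).
Qed.

Lemma enum_setD1 J j : enum (J :\ j)%SET = rem j (enum J).
Proof.
rewrite rem_filter ?enum_uniq// /enum_mem -filter_predI.
by apply: eq_filter => i; rewrite /= !inE.
Qed.

Lemma Vset_rec J m : Vset J m.+1 = Vset J m +
  \sum_(j <- enum J) (-1) ^+ (#|J| + position J j) * lam 0 j ^+ m *
                     Vset (J :\ j)%SET m.
Proof.
rewrite /Vset Vseq_rec; congr (_ + _).
(* A nonempty [J] supplies the default element required by [nth]. *)
case: (pickP (mem J)) => [j0 _|J0]; last first.
  have -> : enum J = [::] by apply/nilP; rewrite /nilp -cardE eq_card0.
  by rewrite big_nil big_ord0.
rewrite [RHS](big_nth j0) big_mkord size_map; apply: eq_bigr => i _.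
have iJ : nth j0 (enum J) i \in J by rewrite -mem_enum mem_nth.
rewrite (nth_map j0)// position_index// index_uniq ?enum_uniq// [#|J|]cardE.
congr (_ * Vseq m _).
by rewrite enum_setD1 remE index_uniq ?enum_uniq// map_cat map_take map_drop.
Qed.

End subset_volume.

(** * Execution of the straight-line program *)

Section program_correctness.
Variables (R : realType) (n : nat).
Implicit Types (s : reg n -> R) (J : {set 'I_n}) (j : 'I_n).
Implicit Types (p q : seq (instr (reg n))).

Lemma write_same s d v : write s d v d = v.
Proof. by rewrite /write eqxx. Qed.

Lemma write_other s d v x : x <> d -> write s d v x = s x.
Proof. by move=> /eqP/negPf xd; rewrite /write xd. Qed.

Lemma run_cat p q s : run (p ++ q) s = run q (run p s).
Proof. exact: foldl_cat. Qed.

Lemma run_flatten_cons (A : Type) (f : A -> seq (instr (reg n))) a l s :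
  run (flatten [seq f b | b <- a :: l]) s =
  run (flatten [seq f b | b <- l]) (run (f a) s).
Proof. exact: run_cat. Qed.

(** Only [Tmp] and the accumulator [Val J m.+1] change, so every summand still reads the initial
    values of level [m]. *)
Lemma run_term_prog m J (l : seq 'I_n) s :
  run (flatten [seq term_prog m J j | j <- l]) s (Val J m.+1) = s (Val J m.+1) +
    \sum_(j <- l) (-1) ^+ (#|J| + position J j) * s (Pow j m) *
                  s (Val (J :\ j)%SET m) /\
  forall x, x <> Tmp -> x <> Val J m.+1 ->
    run (flatten [seq term_prog m J j | j <- l]) s x = s x.
Proof.
elim: l s => [|j l IH] s; first by rewrite big_nil addr0.
rewrite run_flatten_cons; set t := run (term_prog m J j) s.
have tE x : x <> Tmp -> x <> Val J m.+1 -> t x = s x.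
  by move=> xT xJ; rewrite /t /term_prog /run /=; case: ifP => _ /=;
    rewrite !write_other.
have VE I : Val I m <> Val J m.+1 by case => _; lia.
have [-> frame] := IH t; split; last first.
  by move=> x xT xJ; rewrite frame// tE.
rewrite big_cons addrA; congr (_ + _); last first.
  by apply: eq_bigr => i _; rewrite !tE.
rewrite /t /term_prog /run /= -[(-1) ^+ _]signr_odd.
case: ifP => _ /=; rewrite !write_same [write _ Tmp _ (Val _ _)]write_other//.
  by rewrite expr1 mulN1r mulNr.
by rewrite expr0 mul1r.
Qed.

Variables (lam : 'rV[R]_n) (G : 'cV[R]_n).

(** The loop invariant holding before stage [m]. *)
Definition stage_inv m s : Prop :=
  [/\ forall J, s (Val J m) = Vset lam J m,
      forall j, s (Pow j m) = lam 0 j ^+ m,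
      forall j, s (Lam j) = lam 0 j &
      forall j, s (Beta j) = G j 0].

(** Updates read level [m] and write only level [m.+1] and [Tmp], so the invariant survives each of
    them and other results are not disturbed. *)
Lemma run_update_prog m (l : seq {set 'I_n}) s : stage_inv m s ->
  (forall J, J \in l ->
     run (flatten [seq update_prog m J | J <- l]) s (Val J m.+1) =
     Vset lam J m.+1) /\
  forall x, x <> Tmp -> (forall J, J \in l -> x <> Val J m.+1) ->
    run (flatten [seq update_prog m J | J <- l]) s x = s x.
Proof.
have VE I J : Val I m <> Val J m.+1 by case => _; lia.
elim: l s => [|J l IH] s inv_s //.
rewrite run_flatten_cons; set t := run (update_prog m J) s.
have [tJ tE] : t (Val J m.+1) = Vset lam J m.+1 /\
    forall x, x <> Tmp -> x <> Val J m.+1 -> t x = s x.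
  have := run_term_prog m J (enum J) (write s (Val J m.+1) (s (Val J m))).
  rewrite write_same => -[tJ frame]; split=> [|x xT xJ].
    rewrite [LHS]tJ Vset_rec; have [sV sP _ _] := inv_s; rewrite sV.
    by congr (_ + _); apply: eq_bigr => j _; rewrite !write_other// sP sV.
  by rewrite [LHS]frame// write_other.
have inv_t : stage_inv m t.
  by have [sV sP sL sB] := inv_s; split=> i; rewrite tE.
have [IHJ frame] := IH t inv_t; split=> [I|x xT xV].
  (* If [I] recurs later, that later update fixes its value; otherwise the frame property preserves
     the value just written. *)
  rewrite inE; have [/IHJ-> //|Il] := boolP (I \in l).
  rewrite orbF => /eqP IJ; rewrite IJ in Il *.
  by rewrite frame// => K Kl [JK]; rewrite JK Kl in Il.
rewrite frame// => [|K Kl]; last by apply: xV; rewrite inE Kl orbT.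
by rewrite tE//; apply: xV; rewrite inE eqxx.
Qed.

Lemma run_map_frame (A : eqType) (f : A -> instr (reg n)) (l : seq A) s x :
  (forall (t : reg n -> R) a, a \in l -> step t (f a) x = t x) ->
  run [seq f a | a <- l] s x = s x.
Proof.
elim: l s => //= a l IH s fx; rewrite [LHS]IH ?fx ?mem_head// => t b bl.
by rewrite fx// inE bl orbT.
Qed.

(** Each result depends only on registers outside the range of [d], so the writes do not influence
    one another. *)
Lemma run_map_write (A : eqType) (f : A -> instr (reg n)) (d : A -> reg n)
    (v : A -> R) (l : seq A) s :
  injective d ->
  (forall (t : reg n -> R) a x, x <> d a -> step t (f a) x = t x) ->
  (forall (t : reg n -> R) a, (forall x, (forall b, x <> d b) -> t x = s x) ->
     step t (f a) (d a) = v a) ->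
  forall a, a \in l -> run [seq f a | a <- l] s (d a) = v a.
Proof.
move=> dI frame val a; have : forall x, (forall b, x <> d b) -> s x = s x by [].
(* The running state is generalized to any [t] agreeing with [s] off the range of [d]. *)
move: {1 3}s => t; elim: l t => // b l IH t ts.
have st x : (forall b, x <> d b) -> step t (f b) x = s x.
  by move=> xd; rewrite frame// ts.
have [al _|al] := boolP (a \in l); first exact: (IH (step t (f b)) st).
rewrite inE (negPf al) orbF => /eqP ab; rewrite -ab /= in st *.
rewrite [LHS]run_map_frame ?val// => u c cl; apply: frame => /dI ac.
by rewrite ac cl in al.
Qed.

Lemma run_stage_prog m s : stage_inv m s ->
  stage_inv m.+1 (run (stage_prog n m) s).
Proof.
move=> inv_s; rewrite /stage_prog run_cat.
set t := run (flatten _) s.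
have [tV tE] := run_update_prog (enum {set 'I_n}) inv_s.
have [sV sP sL sB] := inv_s.
have tP j : t (Pow j m) = lam 0 j ^+ m by rewrite [LHS]tE// sP.
have tL j : t (Lam j) = lam 0 j by rewrite [LHS]tE// sL.
split=> i.
- rewrite run_map_frame => [|u j _]; last by rewrite /= write_other.
  by rewrite [LHS]tV ?mem_enum.
- apply: (@run_map_write _ _ (fun j => Pow j m.+1) (fun j => lam 0 j ^+ m.+1)).
  + by move=> j k [].
  + by move=> u a x xa /=; rewrite write_other.
  + move=> u a uE /=; rewrite write_same !uE ?tP ?tL ?exprSr// => b [_]; lia.
  + by rewrite mem_enum.
- by rewrite run_map_frame => [//|u j _]; rewrite /= write_other.
- rewrite run_map_frame => [|u j _]; last by rewrite /= write_other.
  by rewrite [LHS]tE ?sB.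
Qed.

Lemma run_init_prog : stage_inv 0 (run (init_prog n) (input lam G)).
Proof.
rewrite /init_prog run_cat; set t := run _ (input lam G).
have tE x : (forall J, x <> Val J 0) -> t x = input lam G x.
  by move=> xV; apply: run_map_frame => u J _ /=; rewrite write_other.
split=> i.
- rewrite run_map_frame => [|u j _]; last by rewrite /= write_other.
  rewrite Vset0.
  apply: (@run_map_write _ _ (fun J => Val J 0)
    (fun J => (J == finset.set0)%:R)).
  + by move=> J K [].
  + by move=> u a x xa /=; rewrite write_other.
  + by move=> u a _ /=; rewrite write_same.
  + by rewrite mem_enum.
- rewrite expr0; apply: (@run_map_write _ _ (fun j => Pow j 0) (fun=> 1)).
  + by move=> J K [].
  + by move=> u a x xa /=; rewrite write_other.
  + by move=> u a _ /=; rewrite write_same.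
  + by rewrite mem_enum.
- rewrite run_map_frame => [|u j _]; last by rewrite /= write_other.
  by rewrite tE.
- rewrite run_map_frame => [|u j _]; last by rewrite /= write_other.
  by rewrite tE.
Qed.

Lemma run_stages N s : stage_inv 0 s ->
  stage_inv N (run (flatten [seq stage_prog n m | m <- iota 0 N]) s).
Proof.
move=> inv_s; elim: N => // N IH.
rewrite -addn1 iotaD map_cat flatten_cat run_cat /= cats0 addn1.
exact: run_stage_prog.
Qed.

Lemma run_prod (l : seq 'I_n) s :
  run [seq IMul Prod Prod (Beta j) | j <- l] s Prod =
  s Prod * \prod_(j <- l) s (Beta j).
Proof.
elim: l s => [|j l IH] s /=; first by rewrite big_nil mulr1.
by rewrite [LHS]IH /= write_same big_cons mulrA.
Qed.

Lemma run_output_prog N s : stage_inv N s ->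
  run (output_prog n N) s Out = `|\prod_(j < n) G j 0| * Vsum N lam.
Proof.
move=> [sV _ _ sB]; rewrite /output_prog -cat1s !run_cat.
rewrite [LHS]/= write_same write_same write_other//.
rewrite run_prod run_map_frame => [|u j _]; last by rewrite /= write_other.
rewrite /= write_same mul1r write_other// sV VsetT big_enum.
by congr (`|_| * _); apply: eq_bigr => j _; rewrite write_other.
Qed.

Lemma run_volume_prog N :
  run (volume_prog n N) (input lam G) Out =
  `|\prod_(j < n) G j 0| * Vsum N lam.
Proof.
rewrite /volume_prog 2!run_cat; apply: run_output_prog.
by apply: run_stages; exact: run_init_prog.
Qed.

End program_correctness.

(** The stage number only labels registers, so all stages cost the same. Initialization uses no
    product; the output uses one per [Beta j] and a final one. *)
Lemma mul_count_volume_prog n N : mul_count (volume_prog n N) =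
  (N * mul_count (stage_prog n 0) + n.+1)%N.
Proof.
have count0 (A : Type) (f : A -> instr (reg n)) (l : seq A) :
    (forall a, ~~ is_mul (f a)) -> count (@is_mul _) [seq f a | a <- l] = 0%N.
  move=> fa; rewrite count_map; elim: l => //= a l ->.
  by rewrite (negPf (fa a)).
have stageE m : mul_count (stage_prog n m) = mul_count (stage_prog n 0).
  rewrite /mul_count /stage_prog !count_cat !count_map; congr (_ + _)%N.
  rewrite !count_flatten -!map_comp; congr (sumn _); apply: eq_map => J /=.
  rewrite !count_flatten -!map_comp; congr (_ + sumn _)%N.
  by apply: eq_map => j /=; case: ifP.
have init0 : mul_count (init_prog n) = 0%N.
  by rewrite /mul_count /init_prog count_cat !count0.
have stages k : mul_count (flatten [seq stage_prog n m | m <- iota k N]) =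
    (N * mul_count (stage_prog n 0))%N.
  elim: N k => //= N IH k; rewrite /mul_count count_cat.
  by rewrite [X in (_ + X)%N]IH mulSn; congr (_ + _)%N; exact: stageE.
have out : mul_count (output_prog n N) = n.+1.
  rewrite /mul_count /output_prog /= count_cat /= count_map add0n addn1.
  by rewrite (eq_count (a2 := predT))// count_predT size_enum_ord.
rewrite -out -(stages 0%N) -[RHS]add0n -[X in (X + _)%N]init0.
by rewrite /mul_count /volume_prog !count_cat.
Qed.

Theorem theorem2 (R : realType) (n : nat) (hn : (1 <= n)%N) :
  (forall (lam : 'rV[R]_n) (G : 'cV[R]_n),
     (forall i, 0 < lam 0 i) ->
     (forall i j : 'I_n, (i < j)%N -> lam 0 i < lam 0 j) ->
     forall N : nat, (1 <= N)%N ->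
       let E := zonotope (reachability_mx (diag_mx lam) G N) in
       [/\ volume E = (`|\prod_(i < n) G i 0| * Vsum N lam)%:E,
           Vsum N lam = Vsum N.-1 lam +
             \sum_(j < n) (-1) ^+ (n + j.+1) * lam 0 j ^+ N.-1 *
                          Vsum N.-1 (col' j lam)
         & volume E = (run (volume_prog n N) (input lam G) Out)%:E]) /\
  (fun N : nat => (mul_count (volume_prog n N))%:R : R^o) =O_\oo
    (fun N : nat => N%:R : R^o).
Proof.
split=> [lam G lam0 ilam [//|N] _ E|].
  have volE : volume E = (`|\prod_(i < n) G i 0| * Vsum N.+1 lam)%:E.
    exact: volume_reachability.
  split; [exact: volE|exact: Vsum_rec|].
  by rewrite volE run_volume_prog.
(* For [N >= 1] the constant cost [n.+1] is at most [n.+1 * N], so it can be added to the cost of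
   one stage. *)
apply/eqO_exP; exists (mul_count (stage_prog n 0) + n.+1)%:R.
  by rewrite ltr0n addnS.
exists 1%N => // N /= N1; rewrite !ger0_norm ?ler0n// -natrM ler_nat.
by rewrite mul_count_volume_prog mulnDl [(N * _)%N]mulnC leq_add2l leq_pmulr.
Qed.
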